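(* Let $\alpha,\beta$ be integers different from $1$ with $v_2(\alpha-1)=v_2(\beta-1)=m\ge 5$, and let $\ell=v_2(\alpha-\beta)$ satisfy $2\ell+2=3m+1$. Write $\alpha=1+2^m u$ with $u$ odd and $\alpha-\beta=2^\ell k$ with $k$ odd, and set $s=v_2(k^2-u^3)$. Then the nilpotency class of $G_2$ is $6$. If $s<(m-3)/2$, then $m\ge 7$, $|G_2|=2^{(13m+2s-3)/2}$, $o(a)=o(b)=2^{(5m+2s+1)/2}$ and $o(c)=2^{2m+s}$. If $s\ge (m-3)/2$, then $|G_2|=2^{7m-3}$, $o(a)=o(b)=2^{3m-1}$ and $o(c)=2^{(5m-3)/2}$.
   Context: $G(\alpha,\beta)=\langle A,B\mid A^{[A,B]}=A^{\alpha},\ B^{[B,A]}=B^{\beta}\rangle$ with $[x,y]=x^{-1}y^{-1}xy$, $y^x=x^{-1}yx$, and $C=[A,B]$. The group $G(\alpha,\beta)$ is finite and nilpotent, hence the direct product of its Sylow subgroups; $G_2$ denotes its Sylow $2$-subgroup and $a,b,c$ denote the images of $A,B,C$ under the canonical projection $G(\alpha,\beta)\to G_2$. $v_2$ is the $2$-adic valuation and $o(x)$ the order of $x$. *)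

(* Defs.v *)
From mathcomp Require Import all_boot all_order all_algebra all_fingroup all_solvable.
From mathcomp Require Import pgroup nilpotent commutator.
Set Implicit Arguments. Unset Strict Implicit. Unset Printing Implicit Defensive.
Import GRing.Theory Num.Theory.

Definition gexpz (gT : finGroupType) (x : gT) (z : int) : gT :=
  match z with
  | Posz n => (x ^+ n)%g
  | Negz n => ((x ^+ n.+1)^-1)%g
  end.

(* 2-adic valuation of an integer (v2 0 = 0 by convention; only used on nonzero
   arguments or guarded explicitly) *)
Definition v2 (z : int) : nat := logn 2 `|z|%N.

(* defining relations of G(alpha,beta):
   A^[A,B] = A^alpha, B^[B,A] = B^beta, with [x,y] = x^-1 y^-1 x y, y^x = x^-1 y x *)
Definition Grels (gT : finGroupType) (al be : int) (x y : gT) : Prop :=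
  (x ^ [~ x, y])%g = gexpz x al /\ (y ^ [~ y, x])%g = gexpz y be.

(* (gT, a, b) is the Sylow 2-subgroup G_2 of G(alpha,beta) with a, b the images
   of A, B: it is the universal finite 2-group generated by two elements
   satisfying the defining relations. *)
Definition is_G2 (gT : finGroupType) (al be : int) (a b : gT) : Prop :=
  [/\ pgroup 2 <<[set a; b]>>%g,
      Grels al be a b &
      forall (hT : finGroupType) (x y : hT),
        Grels al be x y -> pgroup 2 <<[set x; y]>>%g ->
        exists f : {morphism (<<[set a; b]>>%g) >-> hT}, f a = x /\ f b = y].

(* Main.v *)
Require Import Defs.
From mathcomp Require Import all_boot all_order all_algebra all_fingroup all_solvable.
From mathcomp Require Import pgroup nilpotent commutator.
From mathcomp Require Import zify ring.
Set Implicit Arguments. Unset Strict Implicit. Unset Printing Implicit Defensive.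
Import GRing.Theory Num.Theory.

(** Write al = 1 + 2 q^2 u and be = 1 + 2 q^2 v with q = 2^r, so that m = 2r+1, l = 3r+1 and
    u - v = q k.  Every element of the group has the form b^j c^k a^i.

    Upper bound.  Conjugating c b c^-1 = b^be by a gives a closed formula for c^(al - be) as a product
    of a power of b and a power of a.  Since this element commutes with c, the subgroups generated
    by a^(4q^6) and b^(4q^6) coincide and are central; commuting it with a and b then shows that
    a^(4q^6) = 1, that A = a^(2q^5), B = b^(2q^5), C = c^(2q^4) are central, and that
      C^k = B^(v^2) A^(u^2),  C^(v^2) = B^(q v^3) A^(2uk),  C^(u^2) A^(q u^3) = B^(2vk).
    Eliminating C and B leaves A^(4(u^3 - k^2)) = 1, up to an odd exponent, and B in <A>.

    Lower bound.  Right multiplication by a, b, c on words b^j c^l a^i is given by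
      (j, l, i+1),  (j + be^l, l + i, al + ... + al^i),  (j, l+1, al i),
    and left multiplication by a^-1, b, c by
      (1 + be^-1 + ... + be^(1-j), l - j, i - al^l),  (j+1, l, i),  (be j, l+1, i).
    These maps descend to the quotient of Z^3 by the lattice of exponents of the relations found
    above.  There each left map commutes with each right map, and the left maps act transitively;
    hence a right map is determined by the image of one point, so that the right maps are
    permutations, the relations need only be checked at (0, 0, 0), and the group they generate acts
    regularly. *)

(** * Binomial congruences *)

(** The sum starts at [x], not at 1: it is the exponent of [a] that appears when [(a * c) ^+ n] is
    collected. *)
Definition geom_sum (x n : nat) : nat := \sum_(i < n) x ^ i.+1.

Lemma geom_sum0 x : geom_sum x 0 = 0.
Proof. exact: big_ord0. Qed.

Lemma geom_sumS x n : geom_sum x n.+1 = geom_sum x n + x ^ n.+1.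
Proof. exact: big_ord_recr. Qed.

(** Three terms suffice: for [x = 2 q^2 u] the cube of [x] is already divisible by [8 q^6], the
    largest modulus in use. *)
Lemma expn_expand (x n : nat) :
  exists w, (1 + x) ^ n = 1 + n * x + 'C(n, 2) * x ^ 2 + x ^ 3 * w.
Proof.
elim: n => [|n [w IHn]]; first by exists 0; rewrite bin_small //; ring.
exists (w + 'C(n, 2) + w * x).
by rewrite expnS IHn binS bin1; ring.
Qed.

Lemma geom_sum_expand (x n : nat) :
  exists w, geom_sum (1 + x) n =
    n + 'C(n.+1, 2) * x + 'C(n.+1, 3) * x ^ 2 + x ^ 3 * w.
Proof.
elim: n => [|n [w IHn]]; first by exists 0; rewrite geom_sum0 !bin_small //; ring.
have [w' Ew'] := expn_expand x n.+1.
exists (w + w'); rewrite geom_sumS IHn Ew' (binS n.+1 1) (binS n.+1 2) bin1; ring.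
Qed.

Lemma bin2M (n : nat) : 2 * 'C(n.+1, 2) = n.+1 * n.
Proof. by rewrite bin2 mul2n even_halfK //= oddM /=; case: (odd n). Qed.

Lemma bin3M (n : nat) : 6 * 'C(n.+2, 3) = n.+2 * n.+1 * n.
Proof.
elim: n => [//|n IHn]; rewrite binS mulnDr IHn.
by have := bin2M n.+1; nia.
Qed.

Lemma geom_sum_le (x n : nat) : 0 < x -> geom_sum x n <= n * x ^ n.
Proof.
move=> x0; elim: n => [|n IHn]; first by rewrite geom_sum0.
rewrite geom_sumS mulSn addnC leq_add2l (leq_trans IHn) //.
by rewrite leq_mul2l leq_pexp2l ?orbT.
Qed.

Lemma eqmod_witness (M x y s t : nat) : x + M * s = y + M * t -> x = y %[mod M].
Proof. by move=> E; rewrite -(modnMDl s) -(modnMDl t y) addnC mulnC E addnC mulnC. Qed.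

Section Congruences.
Variables (r u : nat).
Hypothesis r_gt1 : 1 < r.
Let q := 2 ^ r.
Let al := 1 + 2 * q ^ 2 * u.

Lemma four_dvd_q : exists p, q = 4 * p.
Proof. by exists (2 ^ (r - 2)); rewrite -[4]/(2 ^ 2) -expnD subnKC. Qed.

Lemma expn_al_2q4 n : exists w, al ^ (2 * q ^ 4 * n) = 1 + 4 * q ^ 6 * (u * n) + 8 * q ^ 6 * w.
Proof.
have [p Eq] := four_dvd_q.
have [w ->] := expn_expand (2 * q ^ 2 * u) (2 * q ^ 4 * n).
case: n => [|n]; first by exists (u ^ 3 * w); rewrite !muln0 bin_small //; ring.
have q0 : 0 < q by rewrite expn_gt0.
set N := 2 * q ^ 4 * n.+1.
have [N' EN] : exists N', N = N'.+1 by exists N.-1; rewrite prednK // !muln_gt0 !expn_gt0.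
have EC : 'C(N, 2) = q ^ 4 * n.+1 * N'.
  by apply/eqP; rewrite -(eqn_pmul2l (isT : 0 < 2)) EN bin2M -EN /N; apply/eqP; ring.
(* The quadratic term is a multiple of [4 q^8], which [q = 4 p] turns into a multiple of [8 q^6]. *)
exists (u ^ 3 * w + 8 * p ^ 2 * n.+1 * N' * u ^ 2).
by rewrite EC /N Eq; ring.
Qed.

Lemma expn_al_even n : exists w, al ^ (2 * n) = 1 + 4 * q ^ 2 * w.
Proof.
have [w ->] := expn_expand (2 * q ^ 2 * u) (2 * n).
exists (u * n + 'C(2 * n, 2) * q ^ 2 * u ^ 2 + 2 * q ^ 4 * u ^ 3 * w); ring.
Qed.

Lemma expn_al_2q3 n : exists w, al ^ (2 * q ^ 3 * n) = 1 + 4 * q ^ 5 * (u * n) + 4 * q ^ 6 * w.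
Proof.
have [w ->] := expn_expand (2 * q ^ 2 * u) (2 * q ^ 3 * n).
case: n => [|n]; first by exists (2 * u ^ 3 * w); rewrite !muln0 bin_small //; ring.
have q0 : 0 < q by rewrite expn_gt0.
set N := 2 * q ^ 3 * n.+1.
have [N' EN] : exists N', N = N'.+1 by exists N.-1; rewrite prednK // !muln_gt0 !expn_gt0.
have EC : 'C(N, 2) = q ^ 3 * n.+1 * N'.
  by apply/eqP; rewrite -(eqn_pmul2l (isT : 0 < 2)) EN bin2M -EN /N; apply/eqP; ring.
exists (2 * u ^ 3 * w + q * n.+1 * N' * u ^ 2).
by rewrite EC /N; ring.
Qed.

Lemma expn_al_2q2 : exists w, al ^ (2 * q ^ 2) = 1 + 4 * q ^ 4 * (u + 2 * w).
Proof.
have [w ->] := expn_expand (2 * q ^ 2 * u) (2 * q ^ 2).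
have [p Eq] := four_dvd_q.
have q0 : 0 < q by rewrite expn_gt0.
set N := 2 * q ^ 2.
have [N' EN] : exists N', N = N'.+1 by exists N.-1; rewrite prednK // !muln_gt0 !expn_gt0.
have EC : 'C(N, 2) = q ^ 2 * N'.
  by apply/eqP; rewrite -(eqn_pmul2l (isT : 0 < 2)) EN bin2M -EN /N; apply/eqP; ring.
exists (q ^ 2 * u ^ 3 * w + 8 * p ^ 2 * N' * u ^ 2).
by rewrite EC /N Eq; ring.
Qed.

Lemma geom_sum_al_2q4 n : exists w,
  geom_sum al (2 * q ^ 4 * n) = 2 * q ^ 4 * n + 2 * q ^ 6 * (u * n) + 8 * q ^ 6 * w.
Proof.
have [p Eq] := four_dvd_q.
have [w ->] := geom_sum_expand (2 * q ^ 2 * u) (2 * q ^ 4 * n).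
case: n => [|n]; first by exists (u ^ 3 * w); rewrite !muln0 !bin_small //; ring.
have q0 : 0 < q by rewrite expn_gt0.
set N := 2 * q ^ 4 * n.+1.
have [N' EN] : exists N', N = N'.+1 by exists N.-1; rewrite prednK // !muln_gt0 !expn_gt0.
have EC : 'C(N.+1, 2) = q ^ 4 * n.+1 * (2 * q ^ 4 * n.+1 + 1).
  by apply/eqP; rewrite -(eqn_pmul2l (isT : 0 < 2)) bin2M addn1 /N; apply/eqP; ring.
(* In [N.+1 * N * N' / 6] the 2 cancels against the factor 2 of [N], and 3 is prime to [q]. *)
have /dvdnP [x Ex] : q ^ 4 %| 'C(N.+1, 3).
  rewrite -(@Gauss_dvdr _ 3) /q; last by rewrite -expnM coprimeXl.
  apply/dvdnP; exists (N.+1 * n.+1 * N').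
  apply/eqP; rewrite -(eqn_pmul2l (isT : 0 < 2)) mulnA EN bin3M -EN -/q /N.
  by apply/eqP; ring.
exists (u ^ 3 * w + 64 * p ^ 4 * 2 * u * n.+1 ^ 2 + 8 * p ^ 2 * u ^ 2 * x).
by rewrite EC Ex /N Eq; ring.
Qed.

Lemma geom_sum_al_2q2 : exists w,
  geom_sum al (2 * q ^ 2) = 2 * q ^ 2 + 2 * q ^ 4 * w.
Proof.
have [w ->] := geom_sum_expand (2 * q ^ 2 * u) (2 * q ^ 2).
set N := 2 * q ^ 2.
have EC : 'C(N.+1, 2) = q ^ 2 * N.+1.
  by apply/eqP; rewrite -(eqn_pmul2l (isT : 0 < 2)) bin2M /N; apply/eqP; ring.
exists (N.+1 * u + 'C(N.+1, 3) * 2 * u ^ 2 + 4 * q ^ 2 * u ^ 3 * w).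
by rewrite EC /N; ring.
Qed.

(* With x = al - 1, the difference al ^ (al + 1) - geom_sum al al is x ^ 2 / 2 + 2 x ^ 3 / 3 + .... *)
Lemma macdonald_exponent : exists h,
  [/\ al ^ al.+1 = geom_sum al al + h,
      2 * q ^ 2 * u * al ^ al = geom_sum al (2 * q ^ 2 * u) + h &
      h = 2 * q ^ 4 * u ^ 2 %[mod 8 * q ^ 6]].
Proof.
set x := 2 * q ^ 2 * u.
have al0 : 0 < al by rewrite /al add1n.
have Eal : al = x.+1 by rewrite /al add1n.
have le1 : geom_sum al x <= x * al ^ al.
  apply: leq_trans (geom_sum_le _ al0) _.
  by rewrite leq_mul2l leq_pexp2l ?orbT // Eal.
(* Both equations have the same difference [h]: [al ^ al] is the last term of [geom_sum al al], and
   also the excess of [al ^ al.+1] over [x * al ^ al]. *)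
have Eg : geom_sum al al = geom_sum al x + al ^ al by rewrite Eal geom_sumS.
have Ep : al ^ al.+1 = x * al ^ al + al ^ al by rewrite expnS Eal mulSn addnC.
exists (x * al ^ al - geom_sum al x); split; last 1 first.
- have [w Ew] := expn_expand x al.+1; have [w' Ew'] := geom_sum_expand x al.
  have E1 : x * al ^ al = x * al ^ al - geom_sum al x + geom_sum al x by rewrite subnK.
  set h := x * al ^ al - geom_sum al x in E1 *.
  have E2 : geom_sum al al + h = al ^ al.+1.
    by rewrite Ep Eg E1; ring.
  have EC2 : 2 * 'C(al.+1, 2) = (x + 2) * (x + 1) by rewrite bin2M Eal; ring.
  have EC3 : 6 * 'C(al.+1, 3) = (x + 2) * (x + 1) * x.
    by rewrite Eal bin3M; ring.
  have Ec3 : 3 * 'C(al.+1, 3) = (q ^ 2 * u) * ((x + 2) * (x + 1)).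
    apply/eqP; rewrite -(eqn_pmul2l (isT : 0 < 2)) mulnA EC3 /x; apply/eqP; ring.
  have EC2' : 'C(al.+1, 2) = (q ^ 2 * u + 1) * (x + 1).
    by apply/eqP; rewrite -(eqn_pmul2l (isT : 0 < 2)) EC2 /x; apply/eqP; ring.
  have /dvdnP [y Ey] : 2 * q ^ 2 %| 'C(al.+1, 3).
    rewrite -(@Gauss_dvdr _ 3) ?Ec3; last by rewrite /q -expnM -expnS coprimeXl.
    by apply/dvdnP; exists (u * (q ^ 2 * u + 1) * (x + 1)); rewrite /x; ring.
  apply: (@eqmod_witness _ _ _ (u ^ 2 * y + u ^ 3 * w') (u ^ 3 * (w + q ^ 2 * u + 1))).
  move: E2; rewrite [geom_sum al al]Ew' [al ^ al.+1]Ew Ey EC2' Eal /x => E2.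
  apply: (@addnI ((2 * q ^ 2 * u).+1 + (q ^ 2 * u + 1) * (2 * q ^ 2 * u + 1) * (2 * q ^ 2 * u))).
  by etransitivity; [|etransitivity; [exact: E2|]]; ring.
- by rewrite Ep Eg addnAC subnKC.
- by rewrite subnKC.
Qed.
End Congruences.

(** * Consequences of the defining relations *)

Section UpperBound.
Local Open Scope group_scope.

(** The presentation in positive words with natural exponents, oriented so that powers of [b] are
    collected on the left and powers of [a] on the right. As [[b, a] = c^-1], the second defining
    relation becomes [c b c^-1 = b^be]. *)
Definition macdonald_rels (gT : finGroupType) (al be : nat) (a b c : gT) : Prop :=
  [/\ a * b = b * a * c, a * c = c * a ^+ al & c * b = b ^+ be * c].

Section Relations.
Variables (gT : finGroupType) (al be : nat) (a b c : gT).
Hypothesis rels : macdonald_rels al be a b c.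

Lemma mac_ab : a * b = b * a * c. Proof. by case: rels. Qed.
Lemma mac_ac : a * c = c * a ^+ al. Proof. by case: rels. Qed.
Lemma mac_cb : c * b = b ^+ be * c. Proof. by case: rels. Qed.

Lemma aXcX i n : a ^+ i * c ^+ n = c ^+ n * a ^+ (al ^ n * i).
Proof.
have aXc j : a ^+ j * c = c * a ^+ (al * j).
  elim: j => [|j IHj]; first by rewrite muln0 mul1g mulg1.
  by rewrite expgS -mulgA IHj mulgA mac_ac -mulgA -expgD mulnS.
elim: n i => [|n IHn] i; first by rewrite mulg1 mul1g expn0 mul1n.
by rewrite expgS mulgA aXc -mulgA IHn mulgA expnSr mulnA.
Qed.

Lemma cXbX n j : c ^+ n * b ^+ j = b ^+ (be ^ n * j) * c ^+ n.
Proof.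
have cbX i : c * b ^+ i = b ^+ (be * i) * c.
  elim: i => [|i IHi]; first by rewrite muln0 mul1g mulg1.
  by rewrite expgS mulgA mac_cb -mulgA IHi mulgA -expgD mulnS.
elim: n j => [|n IHn] j; first by rewrite mulg1 mul1g expn0 mul1n.
by rewrite expgSr -mulgA cbX mulgA IHn -mulgA expnSr mulnA.
Qed.

Lemma acX n : (a * c) ^+ n = c ^+ n * a ^+ geom_sum al n.
Proof.
elim: n => [|n IHn]; first by rewrite geom_sum0 mulg1.
rewrite expgS IHn mulgA -(mulgA a) -expgS -{1}[a]expg1 aXcX muln1 -mulgA -expgD.
by rewrite geom_sumS addnC.
Qed.

(** Conjugation by [b] sends [a] to [a * c], whose powers are collected by [acX]. *)
Lemma aXb i : a ^+ i * b = b * (c ^+ i * a ^+ geom_sum al i).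
Proof.
rewrite -acX; elim: i => [|i IHi]; first by rewrite mul1g mulg1.
by rewrite expgS -mulgA IHi expgS !mulgA mac_ab.
Qed.

(** Mirror image of [aXb]: conjugation by [a] sends [b] to [b * c^-1]. The factor [c ^+ j] on the
    left keeps all exponents natural. *)
Lemma bXa j : c ^+ j * (a^-1 * b ^+ j * a) = b ^+ geom_sum be j.
Proof.
have Eba : a^-1 * b * a = b * c^-1.
  by apply: (mulgI a); rewrite !mulgA mulgV mul1g mac_ab mulgK.
elim: j => [|j IHj]; first by rewrite geom_sum0 mulg1 mulVg mulg1.
have -> : a^-1 * b ^+ j.+1 * a = b * c^-1 * (a^-1 * b ^+ j * a).
  by rewrite -Eba expgS !mulgA mulgK.
have cb1 : c ^+ j.+1 * b = b ^+ (be ^ j.+1) * c ^+ j.+1.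
  by rewrite -{1}[b]expg1 cXbX muln1.
rewrite !mulgA cb1 expgSr !mulgA mulgK -!mulgA (mulgA a^-1) IHj -expgD geom_sumS.
by rewrite addnC.
Qed.

(* The conjugate by a of the relation c * b = b ^+ be * c. *)
Lemma macdonald_relation : 0 < al ->
  b ^+ (be ^ be.+1) * c ^+ be.+1 * a ^+ (al.-1 * al ^ al) =
  b ^+ geom_sum be be * c ^+ al.+1 * a ^+ geom_sum al al.-1.
Proof.
move=> al0; have Eal : al = al.-1.+1 by rewrite prednK.
have Ec : a^-1 * c * a = c * a ^- al.-1.
  apply: (mulIg (a ^+ al.-1)); rewrite mulgKV -mulgA -expgS -Eal -mulgA -mac_ac.
  by rewrite mulKg.
have E : (a^-1 * c * a) * (a^-1 * b * a) = (a^-1 * b ^+ be * a) * (a^-1 * c * a).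
  by rewrite !mulgA !mulgK -(mulgA _ c) mac_cb mulgA.
have Eba : a^-1 * b * a = b * c^-1.
  by apply: (mulgI a); rewrite !mulgA mulgV mul1g mac_ab mulgK.
have Eb : a^-1 * b ^+ be * a = c ^- be * b ^+ geom_sum be be by rewrite -bXa mulKg.
move: E; rewrite Ec Eba Eb => E.
have Ea : a ^- al.-1 * b = b * a ^- geom_sum al al.-1 * c ^- al.-1.
  apply: (mulgI (a ^+ al.-1)); rewrite mulKVg !mulgA aXb !mulgA.
  by rewrite mulgK mulgK.
have Ecal : c ^- al = c ^- al.-1 * c^-1 by rewrite {1}Eal expgS invMg.
have E2 : c * b * a ^- geom_sum al al.-1 * c ^- al = c ^- be * b ^+ geom_sum be be * c * a ^- al.-1.
  by rewrite Ecal -[RHS]mulgA -E -(mulgA c (a ^- _)) (mulgA (a ^- _)) Ea !mulgA.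
have E3 : c ^+ be.+1 * b * a ^- geom_sum al al.-1 = b ^+ geom_sum be be * c * a ^- al.-1 * c ^+ al.
  apply: (mulgI (c ^- be)); apply: (mulIg (c ^- al)).
  by rewrite expgSr !mulgA mulVg mul1g mulgK E2.
have E4 : a ^- al.-1 * c ^+ al = c ^+ al * a ^- (al ^ al * al.-1).
  apply: (mulgI (a ^+ al.-1)); apply: (mulIg (a ^+ (al ^ al * al.-1))).
  by rewrite !mulgA mulgV mul1g mulgKV aXcX.
have cb1 : c ^+ be.+1 * b = b ^+ (be ^ be.+1) * c ^+ be.+1.
  by rewrite -{1}[b]expg1 cXbX muln1.
apply: (mulIg (a ^- geom_sum al al.-1 * a ^- (al ^ al * al.-1))).
rewrite cb1 -(mulgA (_ * c)) E4 in E3.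
have Ecomm : a ^+ (al.-1 * al ^ al) * (a ^- geom_sum al al.-1 * a ^- (al ^ al * al.-1)) = a ^- geom_sum al al.-1.
  by rewrite (mulnC al.-1) -invMg -expgD addnC expgD invMg mulKVg.
rewrite -[LHS]mulgA Ecomm E3 [RHS]mulgA mulgK.
by rewrite expgS !mulgA.
Qed.
End Relations.

(** * Comparison of the cyclic subgroups of powers of [a] and of [b] *)

Lemma expg_addM (gT : finGroupType) (x : gT) M n w : x ^+ M = 1 -> x ^+ (n + M * w) = x ^+ n.
Proof. by move=> xM; rewrite expgD expgM xM expg1n mulg1. Qed.

Lemma expg_dvd1 (gT : finGroupType) (x : gT) M n : x ^+ M = 1 -> M %| n -> x ^+ n = 1.
Proof. by move=> xM /dvdnP[w ->]; rewrite mulnC expgM xM expg1n. Qed.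

Lemma expg_eqmod (gT : finGroupType) (x : gT) M m n :
  x ^+ M = 1 -> (m = n %[mod M])%N -> x ^+ m = x ^+ n.
Proof.
move=> xM Emn; rewrite (divn_eq m M) (divn_eq n M) Emn ![(_ * M + _)%N]addnC ![(_ * M)%N]mulnC.
by rewrite !expg_addM.
Qed.

Lemma cycle_expg_odd (gT : finGroupType) (x : gT) n : 2.-elt x -> odd n -> <[x ^+ n]> = <[x]>.
Proof.
move=> x2 n_odd; apply/esym/eqP; rewrite -[_ == _]/(generator _ _) generator_coprime.
by case/p_natP: x2 => // e ->; rewrite coprimeXl // coprime2n.
Qed.

Lemma cycle_expg_two (gT : finGroupType) (x : gT) : 2.-elt x -> x \in <[x ^+ 2]> -> x = 1.
Proof.
move=> x2 xx2; have: generator <[x]> (x ^+ 2).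
  by rewrite /generator eqEsubset !cycle_subG xx2 mem_cycle.
rewrite generator_coprime; case/p_natP: x2 => // [[|e]] Ex.
  by move=> _; apply/eqP; rewrite -order_eq1 Ex.
by rewrite Ex coprime_sym coprime2n oddX.
Qed.

Section Cycles.
Variables (gT : finGroupType) (al be : nat) (a b c : gT).
Hypothesis rels : macdonald_rels al be a b c.

Lemma norm_cycle_aX i : c \in 'N(<[a ^+ i]>).
Proof.
rewrite inE -cycleJ cycle_subG conjgE -{2}[c]expg1 (aXcX rels) mulKg.
by rewrite expn1 mulnC expgM mem_cycle.
Qed.

Lemma norm_cycle_bX j : c \in 'N(<[b ^+ j]>).
Proof.
rewrite -groupV inE -cycleJ cycle_subG conjgE invgK mulgA -{1}[c]expg1 (cXbX rels) mulgK.
by rewrite expn1 mulnC expgM mem_cycle.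
Qed.

(** The geometric sums occur on both sides of [macdonald_relation] and cancel; only the small
    exponents [hx], [hy] of [macdonald_exponent] survive. *)
Lemma macdonald_relation_cancel hx hy x : al = x.+1 ->
  (be ^ be.+1 = geom_sum be be + hy)%N -> (x * al ^ al = geom_sum al x + hx)%N ->
  b ^+ hy * c ^+ be.+1 * a ^+ hx = c ^+ al.+1.
Proof.
move=> Eal Ehy Ehx; have al0 : 0 < al by rewrite Eal.
have := macdonald_relation rels al0; rewrite [al.-1](_ : _ = x) ?Eal // -Eal Ehx Ehy.
rewrite expgD (addnC (geom_sum al x)) expgD !mulgA => /mulIg.
by rewrite -!mulgA => /mulgI.
Qed.

(** The element [w * a ^+ hx] is a power of [c], hence fixed by conjugation with [c]. This
    conjugation raises powers of [a] to the power [al] and undoes raising powers of [b] to the power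
    [be], so comparing the element with its conjugate isolates the excess powers. *)
Lemma cycle_relation hx hy x y : al = x.+1 -> be = y.+1 ->
  (be ^ be.+1 = geom_sum be be + hy)%N -> (x * al ^ al = geom_sum al x + hx)%N ->
  a ^+ (x * hx) = (b ^+ (y * hy)) ^ (c ^+ be.+2).
Proof.
move=> Eal Ebe Ehy Ehx; have := macdonald_relation_cancel Eal Ehy Ehx.
rewrite [b ^+ hy * _]conjgC; set w := _ ^ _ => Ed.
have cd : (w * a ^+ hx) ^ c = w * a ^+ hx.
  have -> : w * a ^+ hx = c ^- be.+1 * c ^+ al.+1 by rewrite -Ed -!mulgA mulKg.
  by rewrite conjMg conjVg !conjXg conjgE mulKg.
have ac1 : (a ^+ hx) ^ c = a ^+ (al * hx).
  by rewrite conjgE -{2}[c]expg1 (aXcX rels) mulKg expn1.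
have bc1 : (b ^+ (be * hy)) ^ c = b ^+ hy.
  by have := cXbX rels 1 hy; rewrite conjgE expn1 expg1 => <-; rewrite mulKg.
set w1 := (b ^+ hy) ^ (c ^+ be.+2).
have Ew : w = w1 ^+ be by rewrite /w -{1}bc1 -conjgM -expgS -conjXg -expgM mulnC.
have Ewc : w ^ c = w1 by rewrite /w -conjgM -expgSr.
have Ew1 : w1 ^+ be = w1 * w1 ^+ y by rewrite Ebe expgS.
move: cd; rewrite conjMg ac1 Ewc Eal mulSn addnC expgD mulgA => /mulIg.
by rewrite Ew Ew1 => /mulgI ->; rewrite mulnC expgM conjXg.
Qed.
End Cycles.

Lemma eqmod_factor d e h t : 0 < d -> (h = d * t %[mod d * e])%N ->
  exists2 o, (o = t %[mod e])%N & h = (d * o)%N.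
Proof.
move=> d0 E; exists (h %/ (d * e) * e + t %% e)%N; first by rewrite modnMDl modn_mod.
by rewrite {1}(divn_eq h (d * e)) E -muln_modr; ring.
Qed.

(** * Exponents of [a], [b] and [c] *)

Section Orders.
Variables (r u v k : nat).
Hypotheses (r_gt1 : 1 < r) (u_odd : odd u) (v_odd : odd v) (k_odd : odd k).
Let q := (2 ^ r)%N.
Hypothesis Euv : u = (v + q * k)%N.
Let al := (1 + 2 * q ^ 2 * u)%N.
Let be := (1 + 2 * q ^ 2 * v)%N.

Lemma half_square_odd h t : odd t -> (h = 2 * q ^ 4 * t ^ 2 %[mod 8 * q ^ 6])%N ->
  exists2 o, odd o & h = (2 * q ^ 4 * o)%N.
Proof.
move=> t_odd Eh.
have [||o Eo ->] := @eqmod_factor (2 * q ^ 4) (4 * q ^ 2) h (t ^ 2).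
- by rewrite muln_gt0 !expn_gt0.
- by rewrite (_ : 2 * q ^ 4 * (4 * q ^ 2) = 8 * q ^ 6)%N //; ring.
exists o => //; move/(congr1 odd): Eo.
have e4 : odd (4 * q ^ 2) = false by rewrite oddM.
by rewrite !odd_mod // => ->; rewrite oddX t_odd.
Qed.

Section Elements.
Variables (gT : finGroupType) (a b c : gT).
Hypothesis rels : macdonald_rels al be a b c.

(** By [cycle_relation], an odd power of [a ^+ (4 q^6)] is conjugate under a power of [c] to an odd
    power of [b ^+ (4 q^6)]. Odd powers of a 2-element generate the same cycle, and [c] normalises
    cycles generated by powers of [b]. *)
Lemma cycle_a4_b4 : 2.-elt a -> 2.-elt b -> <[a ^+ (4 * q ^ 6)]> = <[b ^+ (4 * q ^ 6)]>.
Proof.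
move=> a2 b2.
have [hx [_ Ehx /(half_square_odd u_odd)[ox ox_odd Ex]]] := macdonald_exponent r u.
have [hy [Ehy _ /(half_square_odd v_odd)[oy oy_odd Ey]]] := macdonald_exponent r v.
have := @cycle_relation _ _ _ _ _ _ rels _ _ _ (2 * q ^ 2 * v) erefl erefl Ehy Ehx.
rewrite Ex Ey (_ : 2 * q ^ 2 * u * _ = 4 * q ^ 6 * (u * ox))%N; last by ring.
rewrite (_ : 2 * q ^ 2 * v * _ = 4 * q ^ 6 * (v * oy))%N; last by ring.
rewrite !(expgM _ (4 * q ^ 6)) => E.
have pX (x : gT) n : 2.-elt x -> 2.-elt (x ^+ n) by move=> x2; apply: p_eltX.
rewrite -(cycle_expg_odd (n := u * ox)) ?oddM ?u_odd ?pX // E cycleJ.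
rewrite (@cycle_expg_odd _ (b ^+ (4 * q ^ 6))) ?oddM ?v_odd ?pX //.
by apply: normP; rewrite groupX // (norm_cycle_bX rels).
Qed.

Section Bounded.
Hypotheses (a8 : a ^+ (8 * q ^ 6) = 1) (b8 : b ^+ (8 * q ^ 6) = 1).

(** Here [al - be = 2 q^3 k]. The power [c ^+ be.+1] can be cancelled because it commutes with
    [a ^+ (2 q^4 u^2)]: [be.+1] is even, so [al ^ be.+1] is 1 modulo [4 q^2]. *)
Lemma c_pow_diff : b ^+ (2 * q ^ 4 * v ^ 2) * a ^+ (2 * q ^ 4 * u ^ 2) = c ^+ (2 * q ^ 3 * k).
Proof.
have [hx [_ Ehx Ex]] := macdonald_exponent r u.
have [hy [Ehy _ Ey]] := macdonald_exponent r v.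
have := macdonald_relation_cancel rels erefl Ehy Ehx.
rewrite (expg_eqmod a8 Ex) (expg_eqmod b8 Ey) -/q.
have Ea : a ^+ (2 * q ^ 4 * u ^ 2) = a ^+ (al ^ be.+1 * (2 * q ^ 4 * u ^ 2)).
  have [w Ew] := expn_al_even r u (1 + q ^ 2 * v).
  rewrite [be.+1](_ : _ = 2 * (1 + q ^ 2 * v))%N; last by rewrite /be; ring.
  rewrite Ew mulnDl mul1n.
  rewrite -/q (_ : 4 * _ * _ * _ = 8 * q ^ 6 * (w * u ^ 2))%N ?expg_addM //; ring.
rewrite {1}Ea -mulgA -(aXcX rels) mulgA [al.+1](_ : _ = 2 * q ^ 3 * k + be.+1)%N.
  by rewrite expgD => /mulIg.
by rewrite /al /be Euv; ring.
Qed.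

(** The conjugate of [b ^+ n] by [a] is computed twice. Through [c_pow_diff] and the action of [c]
    on [a] it is [b ^+ n * a ^- Y]; through [bXa] it involves [c ^+ n]. Equating the two expresses
    [c ^+ n]. *)
Lemma c_pow_half_square : exists w,
  c ^+ (2 * q ^ 4 * v ^ 2) = b ^+ (2 * q ^ 6 * v ^ 3) * a ^+ (4 * q ^ 5 * (u * k) + 4 * q ^ 6 * w).
Proof.
have [w Ew] := expn_al_2q3 r u k; exists w; rewrite -!/q -/al in Ew *.
set Y := (4 * q ^ 5 * _ + _)%N; set n := (2 * q ^ 4 * _)%N.
have Eab : a * b ^+ n = b ^+ n * (a ^+ Y * a).
  apply: (mulIg (a ^+ (2 * q ^ 4 * u ^ 2))).
  rewrite -[LHS]mulgA c_pow_diff -{1}[a]expg1 (aXcX rels) -c_pow_diff Ew muln1 -2!mulgA.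
  by congr (_ * _); rewrite -expgSr -!expgD; congr (_ ^+ _); rewrite /Y; ring.
have Eb : a^-1 * b ^+ n * a = b ^+ n * a ^- Y.
  apply: (mulIg (a ^+ Y)); rewrite mulgKV -!mulgA -expgS expgSr -Eab.
  by rewrite mulKg.
have := bXa rels n; rewrite Eb mulgA (cXbX rels).
have [w1 Ew1] := expn_al_2q4 v r_gt1 (v ^ 2).
have [w2 Ew2] := geom_sum_al_2q4 v r_gt1 (v ^ 2).
rewrite -!/q -!/n -!/be in Ew1 Ew2.
have -> : b ^+ (be ^ n * n) = b ^+ n.
  rewrite Ew1 -addnA mulnDl mul1n (_ : (_ + _) * n = 8 * q ^ 6 * (v ^ 3 * q ^ 4 * v ^ 2 + w1 * n))%N.
    by rewrite expg_addM.
  by rewrite /n; ring.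
rewrite Ew2 expg_addM // (expgD b) -!mulgA => /mulgI E.
rewrite -[c ^+ n](mulgKV (a ^+ Y)) E; congr (_ ^+ _ * _); ring.
Qed.

Lemma a_commute_c n : commute a (c ^+ (2 * q ^ 4 * (2 * n))).
Proof.
rewrite /commute -{1}[a]expg1 (aXcX rels) muln1; congr (_ * _).
have [w ->] := expn_al_2q4 u r_gt1 (2 * n).
by rewrite -addnA (_ : 4 * _ * _ + _ = 8 * q ^ 6 * (u * n + w))%N ?expg_addM ?expg1 // /q; ring.
Qed.

Hypothesis ab4 : commute (a ^+ (4 * q ^ 6)) b.

(** For [i = 4 q^6] the geometric sum in [aXb] is [i] modulo [8 q^6], so commutation of [a ^+ i]
    with [b] leaves [c ^+ i = 1]. *)
Lemma c_pow_4q6 : c ^+ (4 * q ^ 6) = 1.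
Proof.
have [p Eq] := four_dvd_q r_gt1.
have := aXb rels (4 * q ^ 6); rewrite ab4 => /mulgI.
rewrite (_ : a ^+ geom_sum _ _ = a ^+ (4 * q ^ 6)); last first.
  have [w Ew] := geom_sum_al_2q4 u r_gt1 (2 * q ^ 2).
  rewrite [in geom_sum _ _](_ : 4 * q ^ 6 = 2 * q ^ 4 * (2 * q ^ 2))%N; last by ring.
  rewrite Ew expg_addM // -/q -[RHS](expg_addM _ (8 * p ^ 2 * u) a8).
  by congr (_ ^+ _); rewrite /q Eq; ring.
by rewrite -{1}[a ^+ _]mul1g => /mulIg.
Qed.

(** The [q^2]-th power of [c_pow_half_square] kills both factors on the right, and the odd [v^2] is
    removed by [c_pow_4q6]. The factors commute: conjugation by [a] multiplies [b ^+ j] by [c ^- j],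
    which commutes with [a] and has trivial square, so [a ^+ 2] and the even power [a ^+ Y]
    centralise [b ^+ j]. *)
Lemma c_pow_2q6 : c ^+ (2 * q ^ 6) = 1.
Proof.
have [p Eq] := four_dvd_q r_gt1.
have [w Ew] := c_pow_half_square.
set j := (2 * q ^ 6 * v ^ 3)%N in Ew; set Y := (_ + _)%N in Ew.
have Ebj : a^-1 * b ^+ j * a = c ^- j * b ^+ j.
  apply: (mulgI (c ^+ j)); rewrite (bXa rels) mulKVg.
  have [w1 Ew1] := geom_sum_al_2q4 v r_gt1 (q ^ 2 * v ^ 3).
  rewrite [in geom_sum _ _](_ : j = 2 * q ^ 4 * (q ^ 2 * v ^ 3))%N; last by rewrite /j; ring.
  rewrite Ew1 expg_addM // -/q -[RHS](expg_addM _ (4 * p ^ 2 * v ^ 4) b8).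
  by congr (_ ^+ _); rewrite /j /q Eq; ring.
have cj2 : c ^- j * c ^- j = 1.
  by rewrite -invMg -expgD (expg_dvd1 c_pow_4q6) ?invg1 //; apply/dvdnP; exists (v ^ 3)%N; rewrite /j; ring.
have acj : commute a (c ^- j).
  apply: commuteV; have := a_commute_c (8 * p ^ 2 * v ^ 3).
  rewrite (_ : _ * _ = j)%N // /j /q Eq; ring.
have sa2 : commute (b ^+ j) (a ^+ 2).
  apply: (mulgI (a ^- 2)); rewrite mulgA mulKg.
  transitivity (a^-1 * (a^-1 * b ^+ j * a) * a); first by rewrite expgS invMg !mulgA.
  have acVj : a^-1 * c ^- j = c ^- j * a^-1.
    exact: commute_sym (commuteV (commute_sym acj)).
  by rewrite Ebj mulgA acVj -!mulgA (mulgA a^-1) Ebj mulgA cj2 mul1g.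
have sY : commute (b ^+ j) (a ^+ Y).
  rewrite (_ : Y = 2 * (2 * q ^ 5 * (u * k) + 2 * q ^ 6 * w))%N; last by rewrite /Y; ring.
  by rewrite (expgM a); apply: commuteX.
have := congr1 (expgn^~ (q ^ 2)%N) Ew; rewrite /= expgMn // -!expgM.
rewrite (expg_dvd1 b8); last by apply/dvdnP; exists (4 * p ^ 2 * v ^ 3)%N; rewrite /j /q Eq; ring.
rewrite (expg_dvd1 a8); last first.
  by apply/dvdnP; exists (2 * p * (u * k) + 8 * p ^ 2 * w)%N; rewrite /Y /q Eq; ring.
rewrite mulg1 => E; rewrite -[LHS](expg_addM _ (v ^ 2)./2 c_pow_4q6) -[RHS]E.
have Ev : (v ^ 2 = 1 + (v ^ 2)./2.*2)%N by rewrite -{1}(odd_double_half (v ^ 2)) oddX v_odd.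
by congr (_ ^+ _); rewrite {2}Ev -mul2n; ring.
Qed.

Lemma a_commute_b2 n : commute a (b ^+ (2 * q ^ 6 * n)).
Proof.
have [p Eq] := four_dvd_q r_gt1.
set j := (2 * q ^ 6 * n)%N.
have cj : c ^+ j = 1 by rewrite /j expgM c_pow_2q6 expg1n.
have [w1 Ew1] := geom_sum_al_2q4 v r_gt1 (q ^ 2 * n).
have := bXa rels j; rewrite cj mul1g {2}(_ : j = 2 * q ^ 4 * (q ^ 2 * n))%N; last by rewrite /j; ring.
rewrite Ew1 expg_addM // -/q (_ : _ + _ = j + 8 * q ^ 6 * (4 * p ^ 2 * v * n))%N.
  by rewrite expg_addM // => E; rewrite /commute -{1}E !mulgA mulgV mul1g.
by rewrite /j /q Eq; ring.
Qed.

(** By [c_pow_half_square], [c ^+ (2 q^4 v^2)] commutes with [a]. But it conjugates [a] to the power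
    [1 + 4 q^6 u v^2] modulo [8 q^6], and [u v^2] is odd. *)
Lemma a_pow_4q6 : a ^+ (4 * q ^ 6) = 1.
Proof.
have [w Ew] := c_pow_half_square.
have : commute a (c ^+ (2 * q ^ 4 * v ^ 2)).
  by rewrite Ew; apply: commuteM; [apply: a_commute_b2 | apply: commuteX].
rewrite /commute -{1}[a]expg1 (aXcX rels) muln1 => /mulgI.
have [w2 ->] := expn_al_2q4 u r_gt1 (v ^ 2).
rewrite -/q expg_addM // expgD expg1 -[RHS]mulg1 => /mulgI <-.
have Ev : (u * v ^ 2 = 1 + (u * v ^ 2)./2.*2)%N.
  by rewrite -{1}(odd_double_half (u * v ^ 2)) oddM oddX u_odd v_odd.
by rewrite Ev -[LHS](expg_addM _ (u * v ^ 2)./2 a8) -mul2n; congr (_ ^+ _); ring.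
Qed.

End Bounded.
End Elements.

(** The common cycle of [a ^+ (4 q^6)] and [b ^+ (4 q^6)] is centralised by [a] and [b]. Modulo [Z],
    generated by [a ^+ (8 q^6)], the bounded case applies, so [a ^+ (4 q^6)] lies in the cycle of
    its own square and is trivial. *)
Lemma order_dvd_4q6 (gT : finGroupType) (a b c : gT) :
  macdonald_rels al be a b c -> 2.-elt a -> 2.-elt b ->
  a ^+ (4 * q ^ 6) = 1 /\ b ^+ (4 * q ^ 6) = 1.
Proof.
move=> rels a2 b2; have Eab := cycle_a4_b4 rels a2 b2.
suff a4 : a ^+ (4 * q ^ 6) = 1.
  by split=> //; apply/eqP; rewrite -cycle_eq1 -Eab a4 cycle1.
have ab4 : commute (a ^+ (4 * q ^ 6)) b.
  have : a ^+ (4 * q ^ 6) \in <[b ^+ (4 * q ^ 6)]> by rewrite -Eab cycle_id.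
  by case/cycleP=> n ->; apply: commute_sym; do 2!apply: commuteX.
have E86 : (8 * q ^ 6 = 4 * q ^ 6 * 2)%N by ring.
have b8a8 : b ^+ (8 * q ^ 6) \in <[a ^+ (8 * q ^ 6)]>.
  have : b ^+ (4 * q ^ 6) \in <[a ^+ (4 * q ^ 6)]> by rewrite Eab cycle_id.
  by case/cycleP=> n E; rewrite E86 !(expgM _ (4 * q ^ 6)) E (expgAC _ n 2) mem_cycle.
set Z := <[a ^+ (8 * q ^ 6)]> in b8a8.
have aN : a \in 'N(Z).
  by rewrite (subsetP (cent_sub _)) // cent_cycle; apply/cent1P; apply: commuteX.
have bN : b \in 'N(Z).
  rewrite (subsetP (cent_sub _)) // cent_cycle; apply/cent1P; apply: commute_sym.
  by rewrite E86 expgM; apply/commute_sym/commuteX/commute_sym.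
have cN : c \in 'N(Z) by apply: norm_cycle_aX rels _.
have: coset Z a ^+ (4 * q ^ 6) = 1.
  apply: (@a_pow_4q6 _ _ (coset Z b) (coset Z c)).
  - split; rewrite -?morphX -?morphM ?groupX ?groupM //; congr (coset Z _).
    + exact: mac_ab rels.
    + exact: mac_ac rels.
    + exact: mac_cb rels.
  - by rewrite -morphX //; apply: coset_id; apply: cycle_id.
  - by rewrite -morphX //; apply: coset_id.
  - by rewrite /commute -!morphX // -!morphM ?groupX //; congr (coset Z _).
rewrite -morphX // => /coset_idr; rewrite groupX // => /(_ isT).
rewrite /Z E86 (expgM _ _ 2); apply: cycle_expg_two; exact: p_eltX.
Qed.

(** * Relations between the central elements [A], [B], [C] *)

Section Elements4.
Variables (gT : finGroupType) (a b c : gT).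
Hypothesis rels : macdonald_rels al be a b c.
Hypotheses (a4 : a ^+ (4 * q ^ 6) = 1) (b4 : b ^+ (4 * q ^ 6) = 1).

Let a8 : a ^+ (8 * q ^ 6) = 1.
Proof. by apply: expg_dvd1 a4 _; apply/dvdnP; exists 2; ring. Qed.
Let b8 : b ^+ (8 * q ^ 6) = 1.
Proof. by apply: expg_dvd1 b4 _; apply/dvdnP; exists 2; ring. Qed.
Let ab4 : commute (a ^+ (4 * q ^ 6)) b.
Proof. by rewrite a4; apply: commute_sym; apply: commute1. Qed.

Lemma c_2elt : 2.-elt c.
Proof.
have c2 := c_pow_2q6 rels a8 b8 ab4.
rewrite /p_elt; apply: (@pnat_dvd _ (2 * q ^ 6)); first by rewrite order_dvdn c2.
by rewrite /q pnatM !pnatX.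
Qed.

Lemma c_pow_2q5 : c ^+ (2 * q ^ 5) = 1.
Proof.
have [p Eq] := four_dvd_q r_gt1.
have [w Ew] := c_pow_half_square rels a8 b8.
have E : (c ^+ (2 * q ^ 5)) ^+ (v ^ 2) = 1.
  rewrite -expgM (_ : 2 * q ^ 5 * v ^ 2 = 2 * q ^ 4 * v ^ 2 * q)%N; last by ring.
  rewrite expgM Ew expgMn; last by apply: commuteX; apply: commute_sym; apply: a_commute_b2 rels a8 b8 ab4 _.
  rewrite -!expgM (expg_dvd1 b4) ?mul1g ?(expg_dvd1 a4) //; apply/dvdnP.
    by exists (u * k + w * q)%N; ring.
  by exists (2 * p * v ^ 3)%N; rewrite /q Eq; ring.
apply/eqP; rewrite -cycle_eq1 -(@cycle_expg_odd _ _ (v ^ 2)) ?E ?cycle1 ?oddX ?v_odd //.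
exact: p_eltX c_2elt.
Qed.

Lemma c_central n : commute a (c ^+ (2 * q ^ 4 * n)) /\ commute b (c ^+ (2 * q ^ 4 * n)).
Proof.
split; last apply: commute_sym; rewrite /commute.
  rewrite -{1}[a]expg1 (aXcX rels) muln1; congr (_ * _).
  have [w ->] := expn_al_2q4 u r_gt1 n.
  by rewrite -addnA (_ : 4 * _ * _ + _ = 4 * q ^ 6 * (u * n + 2 * w))%N ?expg_addM ?expg1 // /q; ring.
rewrite -{1}[b]expg1 (cXbX rels) muln1; congr (_ * _).
have [w ->] := expn_al_2q4 v r_gt1 n.
by rewrite -addnA (_ : 4 * _ * _ + _ = 4 * q ^ 6 * (v * n + 2 * w))%N ?expg_addM ?expg1 // /q; ring.
Qed.

Lemma a_central n : commute (a ^+ (2 * q ^ 5 * n)) b /\ commute (a ^+ (2 * q ^ 5 * n)) c.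
Proof.
have [p Eq] := four_dvd_q r_gt1.
split; rewrite /commute.
  rewrite (aXb rels); congr (_ * _).
  rewrite (expgM c) c_pow_2q5 expg1n mul1g (_ : 2 * q ^ 5 * n = 2 * q ^ 4 * (q * n))%N; last by ring.
  have [w ->] := geom_sum_al_2q4 u r_gt1 (q * n).
  rewrite -/q -addnA (_ : 2 * q ^ 6 * _ + _ = 4 * q ^ 6 * (2 * p * u * n + 2 * w))%N ?expg_addM //.
  by rewrite /q Eq; ring.
rewrite -{1}[c]expg1 (aXcX rels) expn1; congr (_ * _).
rewrite mulnDl mul1n (_ : 2 * _ * u * _ = 4 * q ^ 6 * (q * u * n))%N ?expg_addM //; ring.
Qed.

Lemma b_central n : commute a (b ^+ (2 * q ^ 5 * n)) /\ commute c (b ^+ (2 * q ^ 5 * n)).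
Proof.
have [p Eq] := four_dvd_q r_gt1.
split; rewrite /commute.
  have := bXa rels (2 * q ^ 5 * n); rewrite (expgM c) c_pow_2q5 expg1n mul1g.
  rewrite {2}(_ : 2 * q ^ 5 * n = 2 * q ^ 4 * (q * n))%N; last by ring.
  have [w ->] := geom_sum_al_2q4 v r_gt1 (q * n).
  rewrite -/q -addnA (_ : 2 * q ^ 6 * _ + _ = 4 * q ^ 6 * (2 * p * v * n + 2 * w))%N ?expg_addM //.
    rewrite [(2 * q ^ 4 * _)%N](_ : _ = 2 * q ^ 5 * n)%N; last by ring.
    by move=> E; rewrite -{1}E !mulgA mulgV mul1g.
  by rewrite /q Eq; ring.
rewrite -{1}[c]expg1 (cXbX rels) expn1; congr (_ * _).
rewrite mulnDl mul1n (_ : 2 * _ * v * _ = 4 * q ^ 6 * (q * v * n))%N ?expg_addM //; ring.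
Qed.

Let A := a ^+ (2 * q ^ 5).
Let B := b ^+ (2 * q ^ 5).
Let C := c ^+ (2 * q ^ 4).

Let A2q : A ^+ (2 * q) = 1.
Proof. by rewrite /A -expgM -[RHS]a4; congr (_ ^+ _); ring. Qed.
Let B2q : B ^+ (2 * q) = 1.
Proof. by rewrite /B -expgM -[RHS]b4; congr (_ ^+ _); ring. Qed.

Lemma C_pow_v2 : C ^+ (v ^ 2) = B ^+ (q * v ^ 3) * A ^+ (2 * u * k).
Proof.
have [w] := c_pow_half_square rels a8 b8; rewrite expg_addM // -!expgM => E.
by rewrite (_ : _ * (2 * u * k) = 4 * q ^ 5 * (u * k))%N 1?(_ : _ * (q * v ^ 3) = 2 * q ^ 6 * v ^ 3)%N //; ring.
Qed.

Let commAB : commute A B.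
Proof. by apply: commuteX; have [] := a_central 1; rewrite muln1. Qed.
Let commAC : commute A C.
Proof.
by apply/commute_sym/commuteX/commute_sym; have [] := c_central 1; rewrite muln1.
Qed.

(** This is the commutator of [b] with [a ^- h] for [h = 2 q^4 u^2], as [ah_b] shows. *)
Let zeta := C ^+ (u ^ 2) * A ^+ (q * u ^ 3).

Lemma ah_b : a ^+ (2 * q ^ 4 * u ^ 2) * b = b * zeta * a ^+ (2 * q ^ 4 * u ^ 2).
Proof.
have [w Ew] := geom_sum_al_2q4 u r_gt1 (u ^ 2).
rewrite (aXb rels) Ew expg_addM // addnC expgD !mulgA; congr (_ * _).
by rewrite /zeta -!expgM; congr (_ * _ ^+ _); rewrite /q; ring.
Qed.

(** The action of [c ^+ (2 q^3 k)] on [b] is known from [cXbX]; in the expression of [c_pow_diff]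
    only the factor in [a] acts, and it contributes [zeta]. *)
Lemma C_pow_u2 : zeta = B ^+ (2 * v * k).
Proof.
have := cXbX rels (2 * q ^ 3 * k) 1.
have [w Ew] := expn_al_2q3 r v k.
rewrite muln1 Ew expg1 -/q expg_addM // -(c_pow_diff rels a8 b8) -mulgA ah_b !mulgA.
set n := (_ * v ^ 2)%N; set Y := (4 * q ^ 5 * _)%N.
have -> : b ^+ (1 + Y) * b ^+ n = b ^+ n * b * b ^+ Y.
  by rewrite -expgSr -!expgD; congr (_ ^+ _); ring.
rewrite /zeta -(mulgA _ (C ^+ _)) => /mulIg /mulgI ->.
by rewrite -expgM; congr (_ ^+ _); rewrite /Y; ring.
Qed.

Lemma ah_bn : commute (b ^+ (2 * q ^ 4 * v ^ 2)) (a ^+ (2 * q ^ 4 * u ^ 2)).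
Proof.
apply: commute_sym; set h := (_ * u ^ 2)%N; set n := (_ * v ^ 2)%N.
have Eb : b ^ (a ^- h) = b * zeta.
  by rewrite conjgE invgK mulgA ah_b mulgK.
have : (b ^+ n) ^ (a ^- h) = b ^+ n.
  rewrite conjXg Eb expgMn; last by rewrite C_pow_u2; do 2!apply: commuteX.
  rewrite C_pow_u2 -!expgM [X in _ * X](expg_dvd1 b4) ?mulg1 //.
  by apply/dvdnP; exists (q ^ 3 * 2 * v * k * v ^ 2)%N; rewrite /n; ring.
by rewrite conjgE invgK mulgA => /(canRL (mulgK _)); rewrite invgK.
Qed.

(** The [q]-th power of [c_pow_diff], whose two factors commute by [ah_bn]. *)
Lemma C_pow_k : C ^+ k = B ^+ (v ^ 2) * A ^+ (u ^ 2).
Proof.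
have := congr1 (expgn^~ q) (c_pow_diff rels a8 b8); rewrite /= (expgMn _ ah_bn) -!expgM => E.
transitivity (c ^+ (2 * q ^ 3 * k * q)); first by congr (_ ^+ _); ring.
by rewrite -E; congr (_ ^+ _ * _ ^+ _); ring.
Qed.

Let mon x y := A ^+ x * B ^+ y.

Let monD x y x' y' : mon x y * mon x' y' = mon (x + x') (y + y').
Proof.
rewrite /mon !expgD !mulgA; congr (_ * _); rewrite -!mulgA; congr (_ * _).
exact: commuteX2 (commute_sym commAB).
Qed.

Let monX x y n : mon x y ^+ n = mon (x * n) (y * n).
Proof. by rewrite /mon expgMn; [rewrite -!(expgM _ _ n) | apply: commuteX2]. Qed.

Let mon_eqmod x y x' y' :
  (x = x' %[mod 2 * q])%N -> (y = y' %[mod 2 * q])%N -> mon x y = mon x' y'.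
Proof. by move=> Ex Ey; rewrite /mon (expg_eqmod A2q Ex) (expg_eqmod B2q Ey). Qed.

Let E := (v ^ 4)%N.
Let K := (v * k ^ 2)%N.

Let u2v2 : exists s, (u ^ 2 = v ^ 2 + 2 * q * s)%N.
Proof.
have [p Eq] := four_dvd_q r_gt1.
by exists (k * v + 2 * p * k ^ 2)%N; rewrite Euv /q Eq; ring.
Qed.

Let q_odd n : odd n -> (q * n = q %[mod 2 * q])%N.
Proof.
move=> n_odd; apply: (@eqmod_witness _ _ _ 0 n./2).
by rewrite -{1}(odd_double_half n) n_odd -mul2n (_ : nat_of_bool true = 1%N) //; ring.
Qed.

Let rel_a : mon E E = mon (2 * K) q.
Proof.
have [s Es] := u2v2.
transitivity (C ^+ (k * v ^ 2)).
  rewrite expgM C_pow_k (commuteX2 _ _ (commute_sym commAB)) -/(mon _ _) monX.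
  apply: mon_eqmod; apply: (@eqmod_witness _ _ _ _ 0).
    by instantiate (1 := (s * v ^ 2)%N); rewrite Es /E; ring.
  by instantiate (1 := 0); rewrite /E; ring.
rewrite mulnC expgM C_pow_v2 (commuteX2 _ _ (commute_sym commAB)) -/(mon _ _) monX.
apply: mon_eqmod; last by rewrite -mulnA; apply: q_odd; rewrite oddM oddX v_odd.
by apply: (@eqmod_witness _ _ _ 0 (k ^ 3)); rewrite Euv /K; ring.
Qed.

(** Two evaluations of [zeta ^+ k], from [C_pow_u2] and from [C_pow_k], followed by [rel_a]. *)
Let rel_b : mon (2 * K + q) q = mon 0 (2 * K).
Proof.
have [s Es] := u2v2.
have zk : zeta ^+ k = mon 0 (2 * K).
  by rewrite C_pow_u2 -expgM /mon mul1g; congr (_ ^+ _); rewrite /K; ring.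
rewrite -zk /zeta expgMn; last exact/commute_sym/commuteX2/commAC.
rewrite (expgAC C) C_pow_k (commuteX2 _ _ (commute_sym commAB)) -/(mon _ _) monX -(expgM A).
rewrite (_ : A ^+ _ = mon q 0); last first.
  rewrite -[LHS]mulg1; apply: (@mon_eqmod _ 0 _ 0) => //; rewrite -mulnA; apply: q_odd.
  by rewrite oddM oddX u_odd.
rewrite monD [RHS](_ : _ = mon (E + q) (E + 0)); last first.
  apply: mon_eqmod; last first.
    by apply: (@eqmod_witness _ _ _ 0 (s * v ^ 2)); rewrite Es /E; ring.
  apply: (@eqmod_witness _ _ _ 0 (2 * s * v ^ 2 + 2 * q * s ^ 2)).
  by rewrite [in LHS](_ : u ^ 2 * u ^ 2 = (v ^ 2 + 2 * q * s) ^ 2)%N ?Es /E; ring.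
by rewrite -monD rel_a monD addn0.
Qed.

Let E_odd : odd E. Proof. by rewrite oddX v_odd. Qed.

(** The [q]-th power of [rel_a]: its right side vanishes modulo [2 q], and [E] is odd. *)
Let rel_c : mon q q = 1.
Proof.
have [p Eq] := four_dvd_q r_gt1.
have := congr1 (expgn^~ q) rel_a; rewrite /= !monX => E1.
have -> : mon q q = mon (E * q) (E * q) by apply: mon_eqmod; rewrite [(E * q)%N]mulnC (q_odd E_odd).
rewrite E1 -[RHS](mulg1 1); apply: (@mon_eqmod _ _ 0 0).
  by apply: (@eqmod_witness _ _ _ 0 K); ring.
by apply: (@eqmod_witness _ _ _ 0 (2 * p)); rewrite /q Eq; ring.
Qed.

(** Elimination of [B] from the power [2 K] of [rel_a] and the power [E] of [rel_b]; the leftover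
    powers of [B] are absorbed by [rel_c]. *)
Lemma A_relation : A ^+ (4 * K * E) = A ^+ (4 * K * K).
Proof.
have Ea := congr1 (expgn^~ (2 * K)%N) rel_a.
have Eb := congr1 (expgn^~ E) rel_b.
rewrite /= !monX in Ea Eb.
have monA x : A ^+ x = mon x 0 by rewrite /mon mulg1.
transitivity (mon (E * (2 * K)) 0 * mon ((2 * K + q) * E) (q * E)).
  transitivity (A ^+ (4 * K * E) * mon q q ^+ E); first by rewrite rel_c expg1n mulg1.
  rewrite monA monX !monD; congr (mon _ _); ring.
rewrite Eb mul0n monD addn0 add0n (mulnC (2 * K)%N E) Ea monA; apply: mon_eqmod.
  by congr (_ %% _)%N; ring.
by apply: (@eqmod_witness _ _ _ 0 K); ring.
Qed.

(** [rel_c] gives [B ^+ q = A ^+ q], so [rel_a] puts the odd power [B ^+ E] into the cycle of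
    [A]. *)
Lemma B_in_A : 2.-elt b -> B \in <[A]>.
Proof.
move=> b2; have Bq : B ^+ q = A ^+ q.
  apply: (mulgI (A ^+ q)); rewrite -/(mon q q) rel_c -expgD.
  by rewrite addnn -mul2n A2q.
rewrite -cycle_subG -(@cycle_expg_odd _ _ E) ?p_eltX // cycle_subG.
have : A ^+ E * B ^+ E \in <[A]> by rewrite -/(mon E E) rel_a /mon Bq groupM ?mem_cycle.
by rewrite groupMl ?mem_cycle.
Qed.

End Elements4.
End Orders.

(** * Normal form and upper bounds for the orders *)

Lemma mem_gen2_normal_form (gT : finGroupType) al be (a b c x : gT) :
  macdonald_rels al be a b c -> x \in <<[set a; b]>> ->
  exists j k i, x = b ^+ j * c ^+ k * a ^+ i.
Proof.
(* In a finite group every element generated by [a] and [b] is a positive word, so only right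
   multiplication by [a] and [b] has to be collected. *)
move=> rels /gen_prodgP[n [s s_ab ->]].
elim: n s s_ab => [|n IHn] s s_ab; first by exists 0, 0, 0; rewrite big_ord0 !mulg1.
rewrite big_ord_recr /=.
have [i|j [k [i ->]]] := IHn (fun i => s (widen_ord (leqnSn n) i)); first exact: s_ab.
have /set2P[->|->] := s_ab ord_max.
  by exists j, k, i.+1; rewrite expgSr mulgA.
exists (j + be ^ k)%N, (k + i)%N, (geom_sum al i).
have cb1 : c ^+ k * b = b ^+ (be ^ k) * c ^+ k.
  by rewrite -{1}[b]expg1 (cXbX rels) muln1.
rewrite -mulgA (aXb rels) !mulgA -(mulgA _ (c ^+ k)) cb1 !mulgA -expgD.
by rewrite -(mulgA _ (c ^+ k)) -expgD.
Qed.

Section Order.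
Variables (r u v k : nat).
Hypotheses (r_gt1 : 1 < r) (u_odd : odd u) (v_odd : odd v) (k_odd : odd k).
Let q := (2 ^ r)%N.
Hypothesis Euv : u = (v + q * k)%N.
Let al := (1 + 2 * q ^ 2 * u)%N.
Let be := (1 + 2 * q ^ 2 * v)%N.
Variables (gT : finGroupType) (a b c : gT).
Hypothesis rels : macdonald_rels al be a b c.
Hypotheses (a2 : 2.-elt a) (b2 : 2.-elt b).

Let a4 : a ^+ (4 * q ^ 6) = 1.
Proof. by have [] := order_dvd_4q6 r_gt1 u_odd v_odd Euv rels a2 b2. Qed.
Let b4 : b ^+ (4 * q ^ 6) = 1.
Proof. by have [] := order_dvd_4q6 r_gt1 u_odd v_odd Euv rels a2 b2. Qed.

Let a8 : a ^+ (8 * q ^ 6) = 1.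
Proof. by apply: expg_dvd1 a4 _; apply/dvdnP; exists 2; ring. Qed.
Let b8 : b ^+ (8 * q ^ 6) = 1.
Proof. by apply: expg_dvd1 b4 _; apply/dvdnP; exists 2; ring. Qed.

(** The exponents in [A_relation] differ by [4 v^2 k^2 (v^3 - k^2)], which is [2 ^ s.+2] times an
    odd number, and [A] is a 2-element. The two alternatives are the two signs of [v^3 - k^2]. *)
Lemma order_a_bound s o : odd o ->
  (v ^ 3 = k ^ 2 + 2 ^ s * o \/ k ^ 2 = v ^ 3 + 2 ^ s * o)%N ->
  a ^+ (2 * q ^ 5 * 2 ^ s.+2) = 1.
Proof.
move=> o_odd Eo; set A := a ^+ (2 * q ^ 5); rewrite expgM -/A.
suff : (A ^+ (2 ^ s.+2)) ^+ (v ^ 2 * k ^ 2 * o) = 1.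
  move=> A1; apply/eqP; rewrite -cycle_eq1 -(@cycle_expg_odd _ _ (v ^ 2 * k ^ 2 * o)) ?A1 ?cycle1 //.
    by do 2!apply: p_eltX.
  by rewrite !oddM ?oddX v_odd k_odd.
have := A_relation r_gt1 u_odd v_odd k_odd Euv rels a4 b4.
rewrite -/q -/A; clearbody A; rewrite -expgM.
have Es : (2 ^ s.+2 = 2 * (2 * 2 ^ s))%N by rewrite !expnS.
rewrite Es; case: Eo => Eo.
  rewrite (_ : 4 * _ * v ^ 4 = 4 * (v * k ^ 2) * (v * k ^ 2) + 2 * (2 * 2 ^ s) * (v ^ 2 * k ^ 2 * o))%N.
    by rewrite expgD -[X in _ = X -> _]mulg1 => /mulgI.
  transitivity (4 * v ^ 2 * k ^ 2 * v ^ 3)%N; first by ring.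
  by rewrite Eo; ring.
rewrite [in RHS](_ : 4 * _ * (v * k ^ 2) = 4 * (v * k ^ 2) * v ^ 4 + 2 * (2 * 2 ^ s) * (v ^ 2 * k ^ 2 * o))%N.
  by rewrite expgD -[X in X = _ -> _]mulg1 => /mulgI.
transitivity (4 * v ^ 2 * k ^ 2 * k ^ 2)%N; first by ring.
by rewrite {2}Eo; ring.
Qed.

(** In the normal form the exponent of [c] can be reduced modulo [2 q^3] by [c_pow_diff], since [k]
    is odd, and then that of [b] modulo [2 q^5] by [B_in_A]. *)
Lemma card_gen2_bound : #|<<[set a; b]>>| <= 2 * q ^ 5 * (2 * q ^ 3) * #[a].
Proof.
have q5 : 0 < 2 * q ^ 5 by rewrite muln_gt0 !expn_gt0.
have q3 : 0 < 2 * q ^ 3 by rewrite muln_gt0 !expn_gt0.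
pose f (t : 'I_(2 * q ^ 5) * 'I_(2 * q ^ 3) * 'I_#[a]) := b ^+ t.1.1 * c ^+ t.1.2 * a ^+ t.2.
suff /subset_leq_card sGf : <<[set a; b]>> \subset [set f t | t in predT].
  by rewrite (leq_trans sGf) // (leq_trans (leq_imset_card _ _)) // cardT -cardE !card_prod !card_ord.
have cD n : exists j i, c ^+ (2 * q ^ 3 * n) = b ^+ j * a ^+ i.
  have c2 := c_2elt r_gt1 v_odd Euv rels a4 b4.
  have : c ^+ (2 * q ^ 3 * n) \in <[c ^+ (2 * q ^ 3 * k)]>.
    by rewrite expgM (expgM _ _ k) cycle_expg_odd ?mem_cycle // p_eltX.
  case/cycleP=> t ->; rewrite -(c_pow_diff Euv rels a8 b8) expgMn -?expgM.
    by do 2!eexists.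
  exact (ah_bn r_gt1 Euv rels a4 b4).
apply/subsetP=> x /(mem_gen2_normal_form rels)[j [k1 [i ->]]].
rewrite {1}(divn_eq k1 (2 * q ^ 3)) addnC expgD [(k1 %/ _ * _)%N]mulnC.
have [j1 [i1 ->]] := cD (k1 %/ (2 * q ^ 3)).
rewrite !mulgA -(mulgA (b ^+ j) (c ^+ _)) (cXbX rels) !mulgA -expgD -(mulgA _ (a ^+ i1)) -expgD.
move: (_ + _)%N (i1 + i)%N => j2 i2.
rewrite {1}(divn_eq j2 (2 * q ^ 5)) addnC expgD [(j2 %/ _ * _)%N]mulnC expgM.
have Bq : b ^+ (2 * q ^ 5) \in <[a ^+ (2 * q ^ 5)]>.
  exact: B_in_A r_gt1 v_odd k_odd Euv _ _ _ _ rels a4 b4 b2.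
have /cycleP[t ->] : b ^+ (2 * q ^ 5) ^+ (j2 %/ (2 * q ^ 5)) \in <[a ^+ (2 * q ^ 5)]>.
  by apply: groupX.
have [_ ac] := a_central r_gt1 v_odd Euv rels a4 b4 t.
rewrite -expgM -(mulgA _ (a ^+ _)) (commuteX _ ac) mulgA -mulgA -expgD -(expg_mod_order a).
apply/imsetP; exists (Ordinal (ltn_pmod j2 q5), Ordinal (ltn_pmod k1 q3), Ordinal (ltn_pmod (2 * q ^ 5 * t + i2) (order_gt0 a))) => //.
Qed.

End Order.

(** * Nilpotency class *)

Lemma mem_ucnS_gen2 (gT : finGroupType) (a b x : gT) n (G := <<[set a; b]>>) :
  x \in G -> [~ x, a] \in 'Z_n(G) -> [~ x, b] \in 'Z_n(G) -> x \in 'Z_n.+1(G).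
Proof.
move=> Gx Zxa Zxb; rewrite ucnSnR inE Gx /=.
have nZG : G \subset 'N('Z_n(G)) := ucn_norm n _.
have nZx : [set x] \subset 'N('Z_n(G)) by rewrite sub1set (subsetP nZG).
have nZab : [set a; b] \subset 'N('Z_n(G)) by apply: subset_trans (subset_gen _) nZG.
rewrite -quotient_cents2 //= quotient_gen // cent_gen.
rewrite quotient_cents2 // gen_subG; apply/subsetP=> _ /imset2P[_ y /set1P-> y_ab ->].
by case/set2P: y_ab => ->.
Qed.

Section NilpotencyClass.
Variables (r u v k : nat).
Hypotheses (r_gt1 : 1 < r) (u_odd : odd u) (v_odd : odd v) (k_odd : odd k).
Let q := (2 ^ r)%N.
Hypothesis Euv : u = (v + q * k)%N.
Let al := (1 + 2 * q ^ 2 * u)%N.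
Let be := (1 + 2 * q ^ 2 * v)%N.
Variables (gT : finGroupType) (a b c : gT).
Hypothesis rels : macdonald_rels al be a b c.
Hypotheses (a2 : 2.-elt a) (b2 : 2.-elt b).
Let G := <<[set a; b]>>.

Let a4 : a ^+ (4 * q ^ 6) = 1.
Proof. by have [] := order_dvd_4q6 r_gt1 u_odd v_odd Euv rels a2 b2. Qed.
Let b4 : b ^+ (4 * q ^ 6) = 1.
Proof. by have [] := order_dvd_4q6 r_gt1 u_odd v_odd Euv rels a2 b2. Qed.

Let Ga : a \in G. Proof. by rewrite mem_gen // set21. Qed.
Let Gb : b \in G. Proof. by rewrite mem_gen // set22. Qed.
Let Ec : c = [~ a, b].
Proof. by apply: (mulgI (b * a)); rewrite -(mac_ab rels) -commgC. Qed.
Let Gc : c \in G. Proof. by rewrite Ec groupR. Qed.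

Let commg_cX_a n y : (al ^ n = 1 + y)%N -> [~ c ^+ n, a] = a ^- y.
Proof.
move=> En; apply: (mulgI (a * c ^+ n)); rewrite -commgC.
by rewrite -{2}[a]expg1 (aXcX rels) muln1 En expgD expg1 mulgA mulgK.
Qed.

Let commg_cX_b n y : (be ^ n = 1 + y)%N -> [~ c ^+ n, b] = (b ^+ y) ^ (c ^+ n).
Proof.
move=> En; apply: (mulgI (b * c ^+ n)); rewrite -commgC -mulgA -conjgC mulgA -expgS.
by rewrite -{1}[b]expg1 (cXbX rels) muln1 En.
Qed.

Let commg_aX_b i y : geom_sum al i = (i + y)%N -> [~ a ^+ i, b] = (c ^+ i) ^ (a ^+ i) * a ^+ y.
Proof.
move=> Ei; apply: (mulgI (b * a ^+ i)); rewrite -commgC (aXb rels) Ei expgD.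
by rewrite conjgE !mulgA mulgK.
Qed.

Let commg_bX_a j y : geom_sum be j = (j + y)%N -> [~ b ^+ j, a] = (c ^- j) ^ (b ^+ j) * b ^+ y.
Proof.
move=> Ej; have := bXa rels j; rewrite Ej expgD => E.
have Eba : (b ^+ j) ^ a = c ^- j * (b ^+ j * b ^+ y).
  by apply: (mulgI (c ^+ j)); rewrite mulKVg -E conjgE !mulgA.
by rewrite commgEl Eba conjgE !mulgA.
Qed.

Let ucnJ n x y : x \in 'Z_n(G) -> y \in G -> x ^ y \in 'Z_n(G).
Proof. by move=> Zx Gy; rewrite memJ_norm // (subsetP (ucn_norm n _)). Qed.

Let ucnS n x : x \in 'Z_n(G) -> x \in 'Z_n.+1(G).
Proof. exact: subsetP (ucn_subS _ _) _. Qed.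

Let central_ucn1 x : x \in G -> commute a x -> commute b x -> x \in 'Z_1(G).
Proof.
move=> Gx ax bx; apply: mem_ucnS_gen2 => //.
  by rewrite (eqP (introT commgP (commute_sym ax))) group1.
by rewrite (eqP (introT commgP (commute_sym bx))) group1.
Qed.

(** The ascent alternates between [c] and the pair [a], [b]. From the central powers it passes to
    [a], [b] to the power [2 q^4] in [Z_2], [c ^+ (2 q^2)] in [Z_3], [a], [b] to the power [2 q^2]
    in [Z_4], and [c] in [Z_5]; the commutators are the excesses in the expansions of [al ^ n] and
    [geom_sum]. *)
Let Z1c n : c ^+ (2 * q ^ 4 * n) \in 'Z_1(G).
Proof.
have [ac bc] := c_central r_gt1 rels a4 b4 n.
by apply: central_ucn1 => //; apply: groupX.
Qed.

Let Z1a n : a ^+ (2 * q ^ 5 * n) \in 'Z_1(G).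
Proof.
have [ab _] := a_central r_gt1 v_odd Euv rels a4 b4 n.
apply: central_ucn1; [exact: groupX | exact: commuteX | exact: commute_sym].
Qed.

Let Z1b n : b ^+ (2 * q ^ 5 * n) \in 'Z_1(G).
Proof.
have [ab _] := b_central r_gt1 v_odd Euv rels a4 b4 n.
by apply: central_ucn1; [exact: groupX | exact: ab | exact: commuteX].
Qed.

Let Z2a n : a ^+ (2 * q ^ 4 * n) \in 'Z_2(G).
Proof.
apply: mem_ucnS_gen2; first exact: groupX.
  by rewrite (eqP (introT commgP _)) ?group1 //; apply: commute_sym; apply: commuteX.
have [w Ew] := geom_sum_al_2q4 u r_gt1 n.
rewrite -/q -addnA in Ew; rewrite (commg_aX_b Ew) groupM ?ucnJ ?Z1c ?(groupX _ Ga) //.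
rewrite (_ : _ + _ = 2 * q ^ 5 * (q * u * n + 4 * q * w))%N ?Z1a //; ring.
Qed.

Let Z2b n : b ^+ (2 * q ^ 4 * n) \in 'Z_2(G).
Proof.
apply: mem_ucnS_gen2; first exact: groupX.
  have [w Ew] := geom_sum_al_2q4 v r_gt1 n.
  rewrite -/q -addnA in Ew; rewrite (commg_bX_a Ew) groupM ?ucnJ ?groupV ?Z1c ?(groupX _ Gb) //.
  by rewrite (_ : _ + _ = 2 * q ^ 5 * (q * v * n + 4 * q * w))%N ?Z1b //; ring.
by rewrite (eqP (introT commgP _)) ?group1 //; apply: commute_sym; apply: commuteX.
Qed.

Let Z3c : c ^+ (2 * q ^ 2) \in 'Z_3(G).
Proof.
apply: mem_ucnS_gen2; first exact: groupX.
  have [w Ew] := expn_al_2q2 u r_gt1; rewrite (commg_cX_a Ew) groupV.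
  by rewrite -/q (_ : _ * _ = 2 * q ^ 4 * (2 * (u + 2 * w)))%N //; ring.
have [w Ew] := expn_al_2q2 v r_gt1; rewrite (commg_cX_b Ew) ucnJ ?(groupX _ Gc) //.
by rewrite -/q (_ : _ * _ = 2 * q ^ 4 * (2 * (v + 2 * w)))%N //; ring.
Qed.

Let Z4a : a ^+ (2 * q ^ 2) \in 'Z_4(G).
Proof.
apply: mem_ucnS_gen2; first exact: groupX.
  by rewrite (eqP (introT commgP _)) ?group1 //; apply: commute_sym; apply: commuteX.
have [w Ew] := geom_sum_al_2q2 r u.
rewrite (commg_aX_b Ew); apply: groupM; last exact: ucnS (Z2a _).
by apply: ucnJ; [apply: Z3c | apply: groupX].
Qed.

Let Z4b : b ^+ (2 * q ^ 2) \in 'Z_4(G).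
Proof.
apply: mem_ucnS_gen2; first exact: groupX.
  have [w Ew] := geom_sum_al_2q2 r v.
  rewrite (commg_bX_a Ew); apply: groupM; last exact: ucnS (Z2b _).
  by apply: ucnJ; [rewrite groupV; apply: Z3c | apply: groupX].
by rewrite (eqP (introT commgP _)) ?group1 //; apply: commute_sym; apply: commuteX.
Qed.

Let Z5c : c \in 'Z_5(G).
Proof.
rewrite -[c]expg1; apply: mem_ucnS_gen2; first exact: groupX.
  rewrite (commg_cX_a (expn1 al)) expgM groupV; apply: groupX; exact: Z4a.
rewrite (commg_cX_b (expn1 be)) expgM; apply: ucnJ; last exact: groupX.
apply: groupX; exact: Z4b.
Qed.

Lemma ucn6_gen2 : 'Z_6(G) = G.
Proof.
apply/eqP; rewrite eqEsubset ucn_sub gen_subG subUset !sub1set.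
apply/and3P; split; first by [].
  apply: mem_ucnS_gen2; [exact: Ga | by rewrite commgg group1 | by rewrite -Ec; exact: Z5c].
apply: mem_ucnS_gen2; [exact: Gb | | by rewrite commgg group1].
rewrite -invgR groupV -Ec; exact: Z5c.
Qed.

(** Gives class at least 6 once [c ^+ (4 q^4)] is known to be nontrivial. The descent passes through
    [c], [a ^+ (2 q^2)], [c ^+ (2 q^2)] up to a power of [a], and [a ^+ (4 q^4)]. *)
Lemma c_in_lcn6 : c ^+ (4 * q ^ 4) \in 'L_6(G).
Proof.
have L n x y : x \in 'L_n.+1(G) -> y \in G -> [~ x, y] \in 'L_n.+2(G).
  by move=> Lx Gy; rewrite lcnSn mem_commg.
have L2c : c \in 'L_2(G) by rewrite Ec L.
have cycle_a n o (H : {group gT}) : odd o -> a ^+ (n * o) \in H -> a ^+ n \in H.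
  by move=> o_odd; rewrite expgM -!cycle_subG (cycle_expg_odd (p_eltX _ a2) o_odd).
have L3a : a ^+ (2 * q ^ 2) \in 'L_3(G).
  apply: cycle_a u_odd _; rewrite -groupV.
  by rewrite -(commg_cX_a (expn1 al)) expg1; apply: L.
have [w Ew] := geom_sum_al_2q2 r u.
have L4 : c ^+ (2 * q ^ 2) ^ a ^+ (2 * q ^ 2) * a ^+ (2 * (2 ^ r) ^ 4 * w) \in 'L_4(G).
  by rewrite -(commg_aX_b Ew) L.
have [w1 Ew1] := expn_al_2q2 u r_gt1.
have L5a : a ^+ (4 * q ^ 4) \in 'L_5(G).
  apply: (@cycle_a _ (u + 2 * w1)); first by rewrite oddD u_odd oddM.
  rewrite -groupV -/q in Ew1 *; rewrite -(commg_cX_a Ew1).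
  have aJ n : a ^ (a ^+ n) = a by apply/conjg_fixP/commgP/commuteX.
  have E : [~ (c ^+ (2 * q ^ 2)) ^ (a ^+ (2 * q ^ 2)), a] = [~ c ^+ (2 * q ^ 2), a].
    transitivity ([~ c ^+ (2 * q ^ 2), a] ^ (a ^+ (2 * q ^ 2))); first by rewrite conjRg aJ.
    by rewrite (commg_cX_a Ew1) conjVg conjXg aJ.
  (* The powers of [a] in the element of [L_4] do not affect its commutator with [a]. *)
  have := L _ _ _ L4 Ga; rewrite commMgJ E (commg_cX_a Ew1) conjVg conjXg aJ.
  rewrite (eqP (introT commgP _)) ?mulg1 //.
  by apply: commute_sym; apply: commuteX.
have [w2 Ew2] := geom_sum_al_2q4 u r_gt1 2.
have := L _ _ _ L5a Gb; rewrite (_ : 4 * q ^ 4 = 2 * q ^ 4 * 2)%N; last by ring.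
rewrite -/q -addnA in Ew2; rewrite (commg_aX_b Ew2).
rewrite (_ : 2 * q ^ 6 * _ + _ = 4 * q ^ 6 * (u + 2 * w2))%N; last by ring.
rewrite (expgM a (4 * q ^ 6)) a4 expg1n mulg1 conjgE.
have [ac _] := c_central r_gt1 rels a4 b4 2.
by rewrite (commuteX _ (commute_sym ac)) mulKg.
Qed.

End NilpotencyClass.

End UpperBound.

(** * A finite group satisfying the relations *)

Section LowerBound.
Local Open Scope ring_scope.

(** Extends the binomial coefficient ['C(i.+1, 2)] to negative [i]; the division is exact. *)
Definition tri (i : int) : int := (i * (i + 1) %/ 2)%Z.

Lemma tri2 i : 2 * tri i = i * (i + 1).
Proof.
have d2 : (2 %| i * (i + 1))%Z.
  rewrite dvdzE abszM Euclid_dvdM // !dvdn2 orbC; lia.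
by rewrite mulrC /tri divzK.
Qed.

Lemma mul2I (x y : int) : 2 * x = 2 * y -> x = y. Proof. lia. Qed.

Lemma triD i d : tri (i + d) = tri i + i * d + tri d.
Proof. by apply: mul2I; rewrite !mulrDr !tri2; ring. Qed.

Lemma tri_double a : tri (2 * a) = a * (2 * a + 1).
Proof. by apply: mul2I; rewrite tri2; ring. Qed.

(** * The lattice of exponents of the relations *)

Section Model.
Variables (q q1 u v k kap om g g' E' tau ta : int).
Hypotheses (Eq : q = 2 * q1) (Ev : v = u - q * k) (Ekap : k * kap = 1 + 2 * q ^+ 2 * om).
Variables (u1 k1 kap1 : int).
Hypotheses (Eu1 : u = 2 * u1 + 1) (Ek1 : k = 2 * k1 + 1) (Ekap1 : kap = 2 * kap1 + 1).
Hypothesis Eg : 2 * q = g * g'.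
Hypothesis EE : 4 * (u ^+ 3 - k ^+ 2) = g * E'.
Hypothesis Etau : 3 * tau = 1 + 4 * q ^+ 6 * ta.

Let E := u ^+ 3 - k ^+ 2.
(** [kap] inverts [k] modulo [2 q^2], so [x] and [y] stand for [v^2 / k] and [u^2 / k]. The value of
    [z] is the solution of [B = A^z] in the upper bound: [A^(v^4) B^(v^4) = A^(2 v k^2) B^q] and
    [B^q = A^q] give [z = 2 k^2 / v^3 + q - 1], which is [1 + q + 2 E] modulo [g] because [g]
    divides [2 q] and [4 E]. *)
Let x := kap * v ^+ 2.
Let y := kap * u ^+ 2.
Let z := 1 + q + 2 * E.
Let lam := 2 * q ^+ 2 * u.
Let mu := 2 * q ^+ 2 * v.
Let M := 4 * q ^+ 6.

(* Exponents (j, i0, i) of the relations b ^ j * c ^ i0 * a ^ i = 1; the generators are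
   c ^ (2 q ^ 3) = b ^ (2 q ^ 4 x) * a ^ (2 q ^ 4 y), b ^ (2 q ^ 5) = a ^ (2 q ^ 5 z) and a ^ (2 q ^ 5 g) = 1. *)
Definition lat (j i0 i : int) : Prop := exists s t w : int,
  [/\ j = - (2 * q ^+ 4 * x * s) + 2 * q ^+ 5 * t, i0 = 2 * q ^+ 3 * s &
      i = - (2 * q ^+ 4 * y * s) - 2 * q ^+ 5 * z * t + 2 * q ^+ 5 * g * w].

Lemma kap2k2 : kap ^+ 2 * k ^+ 2 = (1 + 2 * q ^+ 2 * om) ^+ 2.
Proof. by rewrite -Ekap; ring. Qed.

Lemma xy_even : exists h, y + z * x = 2 * h.
Proof.
exists (kap * u ^+ 2 + kap * (q1 + E) * v ^+ 2 - kap * (u * q * k - q1 * q * k ^+ 2)).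
by rewrite /y /z /x Ev Eq; ring.
Qed.

(** With [B = A^z] and [C = B^x A^y], this is the relation [C^(u^2) A^(q u^3) = B^(2 v k)] raised to
    the power [kap]. *)
Lemma lat_cond_b : exists w, 2 * z * v - y * (y + z * x + q * u) = g * w.
Proof.
(* [X2] is chosen so that [v^2 = u^2 - 2 q X2]; [U] and [Y] are the halves of the even numbers
   [1 + u^3] and [y + u]. The expression then splits into multiples of [2 q = g g'] and of
   [4 E = g E']. *)
pose X2 := u * k - q1 * k ^+ 2.
pose U := 4 * u1 ^+ 3 + 6 * u1 ^+ 2 + 3 * u1 + 1.
pose Y := kap1 * u ^+ 2 + 2 * u1 ^+ 2 + 3 * u1 + 1.
pose P := u - z * k + y * z * kap * X2 - y * Y - u * (4 * q * om + 4 * q ^+ 3 * om ^+ 2).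
exists (g' * P + E' * (u - kap ^+ 2 * u * U)).
have -> : g * (g' * P + E' * (u - kap ^+ 2 * u * U)) = (g * g') * P + (g * E') * (u - kap ^+ 2 * u * U) by ring.
rewrite -Eg -EE -/E.
have EU : 1 + u ^+ 3 = 2 * U by rewrite /U Eu1; ring.
have EY : y + u = 2 * Y by rewrite /Y /y Ekap1 Eu1; ring.
have Ex : x = y - 2 * q * kap * X2 by rewrite /x /y /X2 Ev Eq; ring.
transitivity ((2 * u - 2 * y ^+ 2 * (1 + E)) + 4 * E * u + 2 * q * (u - z * k + y * z * kap * X2) - q * y * (y + u)).
  by rewrite Ex Ev /z; ring.
rewrite EY.
have -> : 2 * u - 2 * y ^+ 2 * (1 + E) = 2 * u * (1 - kap ^+ 2 * k ^+ 2) - 2 * kap ^+ 2 * u * E * (1 + u ^+ 3).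
  by rewrite /y /E; ring.
rewrite EU kap2k2 /P; ring.
Qed.

(** In the same way, this is [C^(v^2) = B^(q v^3) A^(2 u k)] raised to the power [kap]. *)
Lemma lat_cond_a : exists w, x * (y + z * x) - 2 * u - q * z * x * v = g * w.
Proof.
pose X2 := u * k - q1 * k ^+ 2.
pose U := 4 * u1 ^+ 3 + 6 * u1 ^+ 2 + 3 * u1 + 1.
pose Y := kap1 * u ^+ 2 + 2 * u1 ^+ 2 + 3 * u1 + 1.
pose R := (q1 + E) * x * v - q1 * k * y - q * kap * X2 * v.
pose P := - (kap * X2 * (y + z * (x + y))) + y * (Y - u) - R + u * (4 * q * om + 4 * q ^+ 3 * om ^+ 2).
exists (g' * P + E' * (kap ^+ 2 * u * U)).
have -> : g * (g' * P + E' * (kap ^+ 2 * u * U)) = (g * g') * P + (g * E') * (kap ^+ 2 * u * U) by ring.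
rewrite -Eg -EE -/E.
have EU : 1 + u ^+ 3 = 2 * U by rewrite /U Eu1; ring.
have EY : y + u = 2 * Y by rewrite /Y /y Ekap1 Eu1; ring.
have Ex : x = y - 2 * q * kap * X2 by rewrite /x /y /X2 Ev Eq; ring.
have ER : z * x * v = y * u + 2 * R by rewrite /R Ex Ev /z Eq; ring.
transitivity (2 * u * (kap ^+ 2 * k ^+ 2 - 1) + 2 * kap ^+ 2 * u * E * (1 + u ^+ 3)
    + 2 * q * (- (kap * X2 * (y + z * (x + y)))) + q * (y * (y + u) - 2 * y * u - 2 * R)).
  have -> : q * (y * (y + u) - 2 * y * u - 2 * R) = q * (y * (y - u) - 2 * R) by ring.
  have -> : q * z * x * v = q * (y * u + 2 * R) by rewrite -ER; ring.
  by rewrite Ex /z /y /E; ring.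
by rewrite EY EU kap2k2 /P; ring.
Qed.

Lemma lat_add j l i j' l' i' : lat j l i -> lat j' l' i' -> lat (j + j') (l + l') (i + i').
Proof.
move=> [s [t [w [-> -> ->]]]] [s' [t' [w' [-> -> ->]]]].
by exists (s + s'), (t + t'), (w + w'); split; ring.
Qed.

(** Allows the outer coordinates to be computed modulo [4 q^6] and the middle one modulo [2 q^5];
    all error terms below are absorbed here. *)
Lemma lat_mod a b c : lat (M * a) (2 * q ^+ 5 * b) (M * c).
Proof.
have [h Eh] := xy_even.
exists (q ^+ 2 * b), (q * x * b + 2 * q * a), (g' * h * b + g' * z * a + g' * c).
rewrite /M; split; [ring | ring |].
transitivity (2 * q ^+ 5 * (g * g') * (h * b + z * a + c)
    - 2 * q ^+ 6 * b * (y + z * x) - 4 * q ^+ 6 * z * a); last by ring.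
by rewrite -Eg Eh; ring.
Qed.

Lemma lat_eq j l i j' l' i' : lat j l i -> j = j' -> l = l' -> i = i' -> lat j' l' i'.
Proof. by move=> + <- <- <-. Qed.

(** The powers of the relation [c_pow_diff], obtained from the first lattice generator by replacing
    [k * kap] by 1. *)
Lemma lat_D n : lat (- (2 * q ^+ 4 * v ^+ 2 * n)) (2 * q ^+ 3 * k * n) (- (2 * q ^+ 4 * u ^+ 2 * n)).
Proof.
have L0 : lat (- (2 * q ^+ 4 * x * (k * n))) (2 * q ^+ 3 * (k * n)) (- (2 * q ^+ 4 * y * (k * n))).
  by exists (k * n), 0, 0; split; ring.
apply: lat_eq (lat_add L0 (lat_mod (om * v ^+ 2 * n) 0 (om * u ^+ 2 * n))) _ _ _; last 1 first.
- transitivity (- (2 * q ^+ 4 * u ^+ 2 * (k * kap) * n) + M * (om * u ^+ 2 * n)).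
    by rewrite /y; ring.
  by rewrite Ekap /M; ring.
- transitivity (- (2 * q ^+ 4 * v ^+ 2 * (k * kap) * n) + M * (om * v ^+ 2 * n)).
    by rewrite /x; ring.
  by rewrite Ekap /M; ring.
by ring.
Qed.

(* (1 + nu) ^ l and the geometric sum (1 + nu) + ... + (1 + nu) ^ i modulo 4 q ^ 6, as polynomials that
   also make sense for negative exponents; tau stands for 1 / 3. *)
Definition exp_poly (nu l : int) := 1 + nu * l + nu ^+ 2 * (tri l - l).
Definition geom_poly (nu i : int) := i + nu * tri i + nu ^+ 2 * tau * tri i * (i - 1).

Lemma exp_poly_shift n l s : exists c, exp_poly (2 * q ^+ 2 * n) (l + 2 * q ^+ 3 * s) =
  exp_poly (2 * q ^+ 2 * n) l + 4 * q ^+ 5 * n * s + M * c.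
Proof.
exists (q * n ^+ 2 * s * (2 * l + 2 * q ^+ 3 * s - 1)).
rewrite /exp_poly triD (_ : 2 * q ^+ 3 * s = 2 * (q ^+ 3 * s)) ?tri_double; last by ring.
by rewrite /M; ring.
Qed.
Lemma geom_poly_shift n i d : exists c, geom_poly (2 * q ^+ 2 * n) (i + 2 * q ^+ 4 * d) =
  geom_poly (2 * q ^+ 2 * n) i + 2 * q ^+ 4 * d + 2 * q ^+ 6 * n * d + M * c.
Proof.
rewrite /geom_poly triD (_ : 2 * q ^+ 4 * d = 2 * (q ^+ 4 * d)) ?tri_double; last by ring.
exists (n * d * i + n * q ^+ 4 * d ^+ 2 + n ^+ 2 * tau * q ^+ 2 * d *
  (2 * tri i + (2 * i + 2 * q ^+ 4 * d + 1) * (i + 2 * q ^+ 4 * d - 1))).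
by rewrite /M; ring.
Qed.

Lemma exp_poly_add n l d : exists c, exp_poly (2 * q ^+ 2 * n) (l + d) =
  exp_poly (2 * q ^+ 2 * n) l * exp_poly (2 * q ^+ 2 * n) d + M * c.
Proof.
rewrite /exp_poly triD; set b := tri l; set b' := tri d.
exists (- (2 * n ^+ 3 * l * (b' - d) + 2 * n ^+ 3 * d * (b - l) + 4 * q ^+ 2 * n ^+ 4 * (b - l) * (b' - d))).
by rewrite /M; ring.
Qed.

Lemma geom_poly_add n i d : exists c, geom_poly (2 * q ^+ 2 * n) (i + d) =
  geom_poly (2 * q ^+ 2 * n) i + exp_poly (2 * q ^+ 2 * n) i * geom_poly (2 * q ^+ 2 * n) d + M * c.
Proof.
have Ei := tri2 i; have Ed := tri2 d.
rewrite /geom_poly /exp_poly triD; move: Ei Ed; set b := tri i; set b' := tri d => Ei Ed.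
pose c := 4 * q ^+ 4 * n ^+ 2 * ta * (d * b + i * b' - i * d) -
  (2 * n ^+ 3 * i * (b' * tau * (d - 1)) + 2 * n ^+ 3 * (b - i) * (b' + 2 * q ^+ 2 * n * tau * b' * (d - 1))).
exists c.
transitivity (i + d + 2 * q ^+ 2 * n * (b + i * d + b') + (2 * q ^+ 2 * n) ^+ 2 * tau * (b * (i - 1) + b' * (d - 1))
  + (2 * q ^+ 2 * n) ^+ 2 * ((3 * tau) * (d * b + i * b' - i * d))).
  have -> : (2 * q ^+ 2 * n) ^+ 2 * tau * (b + i * d + b') * (i + d - 1) =
    (2 * q ^+ 2 * n) ^+ 2 * tau * (b * (i - 1) + b' * (d - 1) + b * d + b' * i + d * (i * (i + 1)) + i * (d * (d + 1)) - 3 * i * d) by ring.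
  by rewrite -Ei -Ed; ring.
by rewrite Etau /c /M; ring.
Qed.

(** Source of the squares in [lat_D]: for [e = 1 + 2 q^2 n l + ...] one has
    [tri (- e) = e (e - 1) / 2], and [2 q^2 n] times this has leading term [2 q^4 n^2 l]. *)
Lemma geom_poly_opp_exp n l : exists c, geom_poly (2 * q ^+ 2 * n) (- exp_poly (2 * q ^+ 2 * n) l) =
  - exp_poly (2 * q ^+ 2 * n) l + 2 * q ^+ 4 * n ^+ 2 * l + M * c.
Proof.
rewrite /geom_poly /exp_poly; set b := tri l - l; set nu := q ^+ 2 * n.
pose X := nu * l + 2 * nu ^+ 2 * b.
have -> : 1 + 2 * q ^+ 2 * n * l + (2 * q ^+ 2 * n) ^+ 2 * b = 2 * X + 1 by rewrite /X /nu; ring.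
have -> : tri (- (2 * X + 1)) = X * (2 * X + 1).
  by apply: mul2I; rewrite tri2; ring.
exists (n ^+ 3 * (b + (l + 2 * nu * b) ^+ 2
  - 2 * tau * (l + 2 * nu * b) * (2 * X + 1) * (X + 1))).
by rewrite /M /X /nu; ring.
Qed.

(** The one commutation of a right map with a left map that needs more than [lat_mod]: the two
    composites differ by the vector of [lat_D l]. *)
Lemma lat_commute_ba j l i :
  let e := exp_poly mu l in let e' := exp_poly lam l in
  lat (- geom_poly mu (- (j + e)) - (- geom_poly mu (- j) + exp_poly mu (l - j)))
      ((l + i - (j + e)) - (l - j + (i - e')))
      ((geom_poly lam i - exp_poly lam (l + i)) - geom_poly lam (i - e')).
Proof.
move=> e e'.
have [c1 E1] := geom_poly_add v (- j) (- e); have [c2 E2] := exp_poly_add v l (- j).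
have [c3 E3] := geom_poly_opp_exp v l; have [c4 E4] := geom_poly_add u i (- e').
have [c5 E5] := exp_poly_add u l i; have [c6 E6] := geom_poly_opp_exp u l.
rewrite -/lam -/mu -/e -/e' in E1 E2 E3 E4 E5 E6.
pose vj := v * (- j + 2 * q ^+ 2 * v * (tri (- j) - - j)).
pose ui := u * (i + 2 * q ^+ 2 * u * (tri i - i)).
have Ej : exp_poly mu (- j) * (2 * q ^+ 4 * v ^+ 2 * l) = 2 * q ^+ 4 * v ^+ 2 * l + M * (v ^+ 2 * l * vj).
  by rewrite /exp_poly /mu /M /vj; ring.
have Ei : exp_poly lam i * (2 * q ^+ 4 * u ^+ 2 * l) = 2 * q ^+ 4 * u ^+ 2 * l + M * (u ^+ 2 * l * ui).
  by rewrite /exp_poly /lam /M /ui; ring.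
have Ee : e' - e = 2 * q ^+ 3 * k * l + 2 * q ^+ 5 * (2 * k * (u + v) * (tri l - l)).
  by rewrite /e /e' /exp_poly /lam /mu Ev; ring.
clearbody e e'; rewrite (_ : - (j + e) = - j - e); last by ring.
apply: lat_eq (lat_add (lat_D l) (lat_mod (- v ^+ 2 * l * vj - exp_poly mu (- j) * c3 - c1 - c2)
  (2 * k * (u + v) * (tri l - l)) (- u ^+ 2 * l * ui - exp_poly lam i * c6 - c4 - c5))) _ _ _.
- transitivity (- (exp_poly mu (- j) * (2 * q ^+ 4 * v ^+ 2 * l)) + M * (- exp_poly mu (- j) * c3 - c1 - c2)).
    by rewrite Ej; ring.
  by rewrite E1 E2 E3; ring.
- by rewrite -Ee; ring.
- transitivity (- (exp_poly lam i * (2 * q ^+ 4 * u ^+ 2 * l)) + M * (- exp_poly lam i * c6 - c4 - c5)).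
    by rewrite Ei; ring.
  by rewrite E4 E5 E6; ring.
Qed.

(** The vector is what [right_b] adds, up to [lat_mod], to a displacement by the lattice vector with
    coefficients [s], [t], [w]; it lies in the lattice by [lat_cond_b]. *)
Lemma lat_step_b s t w : exists c,
  lat (4 * q ^+ 5 * v * s) (2 * q ^+ 4 * (- (y * s) - q * z * t + q * g * w))
      (2 * q ^+ 6 * u * (- (y * s) - q * z * t + q * g * w) + M * c).
Proof.
have [h Eh] := xy_even; have [om4 Eom] := lat_cond_b.
set D := - (y * s) - q * z * t + q * g * w.
pose t' := 2 * v * s + x * D.
pose G := - (z * t) + g * w.
exists (- (h * G + q1 * u * G)), (q * D), t', (s * om4); split; rewrite /t' ?/M; [ring|ring|].
transitivity (- (2 * q ^+ 4 * y * (q * D)) - 2 * q ^+ 5 * z * (2 * v * s + x * D)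
   + 2 * q ^+ 5 * s * (2 * z * v - y * (y + z * x + q * u))); last by rewrite Eom; ring.
transitivity (- (2 * q ^+ 5 * (q * G * (y + z * x) + s * y * q * u))); last first.
  by rewrite /D /G; ring.
have -> : D = - (y * s) + q * G by rewrite /D /G; ring.
rewrite Eh; transitivity (2 * q ^+ 6 * u * (- (y * s) + q * G) - 4 * q ^+ 6 * h * G - 2 * q ^+ 6 * (2 * q1) * u * G).
  by ring.
by rewrite -Eq; ring.
Qed.

(** The analogue for [left_a], by [lat_cond_a]. *)
Lemma lat_step_a s t :
  let D := - (x * s) + q * t in
  lat (2 * q ^+ 6 * v * D) (- (2 * q ^+ 4 * D)) (- (4 * q ^+ 5 * u * s)).
Proof.
move=> D; have [h Eh] := xy_even; have [om5 Eom] := lat_cond_a.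
exists (- (q * D)), (q * v * D - x * D), (s * om5 - g' * t * (h - q1 * z * v)); split; [ring|ring|].
transitivity (2 * q ^+ 4 * y * q * D - 2 * q ^+ 5 * z * (q * v * D - x * D)
  + 2 * q ^+ 5 * (s * (g * om5) - (g * g') * t * (h - q1 * z * v))); last by ring.
rewrite -Eom -Eg.
transitivity (2 * q ^+ 5 * (D * (y + z * x) - q * z * v * D
  + s * (x * (y + z * x) - 2 * u - q * z * x * v) - q * t * (2 * h - (2 * q1) * z * v))); last by ring.
by rewrite -Eq -Eh /D; ring.
Qed.

Lemma lat_compat_b dj dl di j l i : lat dj dl di ->
  lat ((j + dj + exp_poly mu (l + dl)) - (j + exp_poly mu l)) ((l + dl + (i + di)) - (l + i))
      (geom_poly lam (i + di) - geom_poly lam i).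
Proof.
move=> L; have [s [t [w [Ej El Ei]]]] := L.
have [c Lb] := lat_step_b s t w.
set D := - (y * s) - q * z * t + q * g * w in Lb.
have EiD : di = 2 * q ^+ 4 * D by rewrite Ei /D; ring.
have [c1 E1] := exp_poly_shift v l s; have [c2 E2] := geom_poly_shift u i D.
rewrite -El -/mu in E1; rewrite -EiD -/lam in E2.
apply: lat_eq (lat_add (lat_add L Lb) (lat_mod c1 0 (c2 - c))) _ _ _.
- by rewrite E1; ring.
- by rewrite EiD; ring.
- by rewrite E2; ring.
Qed.

Lemma lat_compat_a dj dl di j l i : lat dj dl di ->
  lat (- geom_poly mu (- (j + dj)) - - geom_poly mu (- j)) ((l + dl - (j + dj)) - (l - j))
      ((i + di - exp_poly lam (l + dl)) - (i - exp_poly lam l)).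
Proof.
move=> L; have [s [t [w [Ej El Ei]]]] := L.
have La := lat_step_a s t; cbv zeta in La.
set D := - (x * s) + q * t in La.
have EjD : dj = 2 * q ^+ 4 * D by rewrite Ej /D; ring.
have [c1 E1] := exp_poly_shift u l s; have [c2 E2] := geom_poly_shift v (- j) (- D).
rewrite -El -/lam in E1; rewrite mulrN -EjD -/mu in E2.
apply: lat_eq (lat_add (lat_add L La) (lat_mod (- c2) 0 (- c1))) _ _ _.
- by rewrite (opprD j dj) E2; ring.
- by rewrite EjD; ring.
- by rewrite E1; ring.
Qed.

End Model.

(** * The regular permutation group on the quotient of Z^3 *)

Lemma ordz_subproof m (m0 : (0 < m)%N) (z : int) : (`|(z %% m)%Z|%N < m)%N.
Proof. have := @ltz_pmod z m; have := @modz_ge0 z m; lia. Qed.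

Definition ordz m (m0 : (0 < m)%N) (z : int) : 'I_m := Ordinal (ordz_subproof m0 z).

Lemma ordz_eq m (m0 : (0 < m)%N) z z' : ordz m0 z = ordz m0 z' <-> exists t, z - z' = m%:Z * t.
Proof.
have mod_ge0 t : (0 <= (t %% m)%Z) by apply: modz_ge0; lia.
split=> [/(congr1 val) /= /(congr1 Posz) | [t Et]].
  rewrite !gez0_abs // => /eqP; rewrite eqz_mod_dvd => /dvdzP[t ->].
  by exists t; rewrite mulrC.
apply: val_inj => /=; congr `|_|%N; apply/eqP; rewrite eqz_mod_dvd.
by apply/dvdzP; exists t; rewrite Et mulrC.
Qed.

Lemma ordz_val m (m0 : (0 < m)%N) (x : 'I_m) : ordz m0 x%:Z = x.
Proof. by apply: val_inj; rewrite /= modz_small // ltz_nat ltn_ord. Qed.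

Lemma nat_shift (M z : int) : 0 < M -> exists (n : nat) (t : int), n%:Z = z + M * t.
Proof. by move=> M0; exists (absz (z + M * `|z|)), `|z|; rewrite gez0_abs //; nia. Qed.

Lemma dvdn_of_int (m n : nat) (w : int) : n%:Z = m%:Z * w -> (m %| n)%N.
Proof.
by move=> E; have: (m%:Z %| n%:Z)%Z by apply/dvdzP; exists w; rewrite E mulrC.
Qed.

Lemma pow2_coprimez n (a b : int) : a = 2 * b + 1 -> coprimez (2 ^ n)%N a.
Proof. by move=> Ea; rewrite coprimezE coprimeXl // coprime2n; lia. Qed.

Section Permutations.
Variables (Q G : nat).
Hypotheses (Q_gt0 : (0 < Q)%N) (G_gt0 : (0 < G)%N).
Let q : int := Q%:Z.
Let g : int := G%:Z.
Variables (q1 u v k kap om g' E' tau ta : int).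
Hypotheses (Eq : q = 2 * q1) (Ev : v = u - q * k) (Ekap : k * kap = 1 + 2 * q ^+ 2 * om).
Variables (u1 k1 kap1 : int).
Hypotheses (Eu1 : u = 2 * u1 + 1) (Ek1 : k = 2 * k1 + 1) (Ekap1 : kap = 2 * kap1 + 1).
Hypothesis Eg : 2 * q = g * g'.
Hypothesis EE : 4 * (u ^+ 3 - k ^+ 2) = g * E'.
Hypothesis Etau : 3 * tau = 1 + 4 * q ^+ 6 * ta.

Let x := kap * v ^+ 2.
Let y := kap * u ^+ 2.
Let z := 1 + q + 2 * (u ^+ 3 - k ^+ 2).
Let lam := 2 * q ^+ 2 * u.
Let mu := 2 * q ^+ 2 * v.

Let m3 := (2 * Q ^ 3)%N.
Let m5 := (2 * Q ^ 5)%N.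
Let mg := (2 * Q ^ 5 * G)%N.
Let m3_gt0 : (0 < m3)%N. Proof. by rewrite /m3 muln_gt0 expn_gt0 Q_gt0. Qed.
Let m5_gt0 : (0 < m5)%N. Proof. by rewrite /m5 muln_gt0 expn_gt0 Q_gt0. Qed.
Let mg_gt0 : (0 < mg)%N. Proof. by rewrite /mg muln_gt0 m5_gt0. Qed.
Let Em3 : m3%:Z = 2 * q ^+ 3. Proof. by rewrite /m3 PoszM -[Posz (Q ^ 3)]natz natrX natz. Qed.
Let Em5 : m5%:Z = 2 * q ^+ 5. Proof. by rewrite /m5 PoszM -[Posz (Q ^ 5)]natz natrX natz. Qed.
Let Emg : mg%:Z = 2 * q ^+ 5 * g. Proof. by rewrite /mg PoszM -/m5 Em5. Qed.

Notation X := ('I_m5 * 'I_m3 * 'I_mg)%type.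
Notation latq := (lat q u v k kap g).

(** A unimodular change of coordinates makes the lattice diagonal, with moduli [2 q^5], [2 q^3] and
    [2 q^5 g], so the quotient is a product of three ordinal types. *)
Definition lat_class (p : int * int * int) : X :=
  let: (j, l, i) := p in
  (ordz m5_gt0 (j + q * x * l), ordz m3_gt0 l, ordz mg_gt0 (i + q * y * l + z * (j + q * x * l))).

Arguments lat_class p : simpl never.

Definition lat_repr (p : X) : int * int * int :=
  let: (j, l, i) := p in (j%:Z - q * x * l, l%:Z, i%:Z - q * y * l - z * j).

Lemma lat_reprK : cancel lat_repr lat_class.
Proof.
case=> [[j l] i]; rewrite /lat_class /lat_repr; congr (_, _, _).
- by rewrite -[RHS](ordz_val m5_gt0); congr ordz; ring.
- exact: ordz_val.
- by rewrite -[RHS](ordz_val mg_gt0); congr ordz; ring.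
Qed.

Lemma lat_class_eq j l i j' l' i' :
  lat_class (j, l, i) = lat_class (j', l', i') <-> latq (j - j') (l - l') (i - i').
Proof.
split.
  move=> E; have /ordz_eq[t Et] := congr1 (fun p : X => p.1.1) E.
  have /ordz_eq[s Es] := congr1 (fun p : X => p.1.2) E.
  have /ordz_eq[w Ew] := congr1 (fun p : X => p.2) E.
  rewrite Em5 in Et; rewrite Em3 in Es; rewrite Emg in Ew.
  have Ej : j - j' = - (q * x * (l - l')) + 2 * q ^+ 5 * t by rewrite -Et; ring.
  have Ei : i - i' = - (q * y * (l - l')) - z * (2 * q ^+ 5 * t) + 2 * q ^+ 5 * g * w.
    by rewrite -Et -Ew; ring.
  exists s, t, w; rewrite -/x -/y -/z; split=> //; rewrite ?Ej ?Ei Es; ring.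
case=> s [t [w]]; rewrite -/x -/y -/z => -[Ej El Ei].
have Et : (j + q * x * l) - (j' + q * x * l') = 2 * q ^+ 5 * t.
  by transitivity ((j - j') + q * x * (l - l')); [ring | rewrite Ej El; ring].
rewrite /lat_class; congr (_, _, _); apply/ordz_eq.
- by exists t; rewrite Em5.
- by exists s; rewrite Em3.
exists w; rewrite Emg.
transitivity ((i - i') + q * y * (l - l') + z * ((j + q * x * l) - (j' + q * x * l'))); first by ring.
by rewrite Et Ei El; ring.
Qed.

Let lat_b := lat_compat_b tau Eq Ev Ekap Eu1 Ekap1 Eg EE.
Let lat_a := lat_compat_a tau Eq Ev Ekap Eu1 Ekap1 Eg EE.
Let lat_ba := lat_commute_ba Eq Ev Ekap Eg Etau.
Let lat_M := lat_mod kap Eq Ev Eg.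

Notation T := (int * int * int)%type.
Definition right_a (p : T) : T := (p.1.1, p.1.2, p.2 + 1).
Definition right_b (p : T) : T := (p.1.1 + exp_poly mu p.1.2, p.1.2 + p.2, geom_poly tau lam p.2).
Definition right_c (p : T) : T := (p.1.1, p.1.2 + 1, (1 + lam) * p.2).
Definition left_a (p : T) : T := (- geom_poly tau mu (- p.1.1), p.1.2 - p.1.1, p.2 - exp_poly lam p.1.2).
Definition left_b (p : T) : T := (p.1.1 + 1, p.1.2, p.2).
Definition left_c (p : T) : T := ((1 + mu) * p.1.1, p.1.2 + 1, p.2).

Definition compat (F : T -> T) := forall p p', lat_class p = lat_class p' -> lat_class (F p) = lat_class (F p').
Definition bar (F : T -> T) (t : X) : X := lat_class (F (lat_repr t)).

Lemma barE F p : compat F -> bar F (lat_class p) = lat_class (F p).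
Proof. by apply; apply: lat_reprK. Qed.

Let lat_small j l i : latq j l i -> exists a b, j = 2 * q ^+ 4 * a /\ i = 2 * q ^+ 4 * b.
Proof.
move=> [s [t [w [-> _ ->]]]]; exists (- (x * s) + q * t), (- (y * s) - q * z * t + q * g * w).
by split; rewrite /x /y /z; ring.
Qed.

Let addBK (a b : int) : b + (a - b) = a. Proof. ring. Qed.

Lemma compat_right_a : compat right_a.
Proof.
move=> [[j l] i] [[j' l'] i'] /lat_class_eq L; apply/lat_class_eq.
by apply: lat_eq L _ _ _ => /=; ring.
Qed.

Lemma compat_right_b : compat right_b.
Proof.
move=> [[j l] i] [[j' l'] i'] /lat_class_eq L; apply/lat_class_eq => /=.
by have := @lat_b _ _ _ j' l' i' L; rewrite !addBK.
Qed.

Lemma compat_right_c : compat right_c.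
Proof.
move=> [[j l] i] [[j' l'] i'] /lat_class_eq L; apply/lat_class_eq => /=.
have [_ [b [_ Eb]]] := lat_small L.
apply: lat_eq (lat_add L (lat_M 0 0 (u * b))) _ _ _; [ring | ring |].
transitivity ((i - i') + 2 * q ^+ 2 * u * (2 * q ^+ 4 * b)); first by ring.
by rewrite -Eb /lam; ring.
Qed.

Lemma compat_left_a : compat left_a.
Proof.
move=> [[j l] i] [[j' l'] i'] /lat_class_eq L; apply/lat_class_eq => /=.
by have := @lat_a _ _ _ j' l' i' L; rewrite !addBK.
Qed.

Lemma compat_left_b : compat left_b.
Proof.
move=> [[j l] i] [[j' l'] i'] /lat_class_eq L; apply/lat_class_eq.
by apply: lat_eq L _ _ _ => /=; ring.
Qed.

Lemma compat_left_c : compat left_c.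
Proof.
move=> [[j l] i] [[j' l'] i'] /lat_class_eq L; apply/lat_class_eq => /=.
have [a [_ [Ea _]]] := lat_small L.
apply: lat_eq (lat_add L (lat_M (v * a) 0 0)) _ _ _; [|ring|ring].
transitivity ((j - j') + 2 * q ^+ 2 * v * (2 * q ^+ 4 * a)); first by ring.
by rewrite -Ea /mu; ring.
Qed.

Let exp_poly_succ n l : exists c,
  exp_poly (2 * q ^+ 2 * n) (l + 1) = (1 + 2 * q ^+ 2 * n) * exp_poly (2 * q ^+ 2 * n) l + 4 * q ^+ 6 * c.
Proof.
exists (- (2 * n ^+ 3 * (tri l - l))); rewrite /exp_poly triD (_ : tri 1 = 1) //; ring.
Qed.

Definition commutes (R L : T -> T) := forall t, bar R (bar L t) = bar L (bar R t).

Let commutesI R L : compat R -> compat L ->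
  (forall p, lat_class (R (L p)) = lat_class (L (R p))) -> commutes R L.
Proof. by move=> cR cL RL t; rewrite -[t]lat_reprK !barE. Qed.

Lemma commutes_aa : commutes right_a left_a.
Proof.
apply: commutesI compat_right_a compat_left_a _ => -[[j l] i].
by congr lat_class; rewrite /right_a /left_a /= addrAC.
Qed.

Lemma commutes_ab : commutes right_a left_b.
Proof. exact: commutesI compat_right_a compat_left_b _. Qed.

Lemma commutes_ac : commutes right_a left_c.
Proof. exact: commutesI compat_right_a compat_left_c _. Qed.

Lemma commutes_ba : commutes right_b left_a.
Proof.
apply: commutesI compat_right_b compat_left_a _ => -[[j l] i].
apply/esym/lat_class_eq => /=; exact: lat_ba.
Qed.

Lemma commutes_bb : commutes right_b left_b.
Proof.
apply: commutesI compat_right_b compat_left_b _ => -[[j l] i].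
by congr lat_class; rewrite /right_b /left_b /= addrAC.
Qed.

Lemma commutes_bc : commutes right_b left_c.
Proof.
apply: commutesI compat_right_b compat_left_c _ => -[[j l] i]; apply/lat_class_eq => /=.
have [c Ec] := exp_poly_succ v l; apply: lat_eq (lat_M c 0 0) _ _ _; [|ring|ring].
by rewrite /mu Ec; ring.
Qed.

Lemma commutes_ca : commutes right_c left_a.
Proof.
apply: commutesI compat_right_c compat_left_a _ => -[[j l] i]; apply/lat_class_eq => /=.
have [c Ec] := exp_poly_succ u l; apply: lat_eq (lat_M 0 0 c) _ _ _; [ring|ring|].
by rewrite /lam Ec; ring.
Qed.

Lemma commutes_cb : commutes right_c left_b.
Proof. exact: commutesI compat_right_c compat_left_b _. Qed.

Lemma commutes_cc : commutes right_c left_c.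
Proof. exact: commutesI compat_right_c compat_left_c _. Qed.

Let p0 : X := lat_class (0, 0, 0).

Let ff0 nu : geom_poly tau nu 0 = 0.
Proof. by rewrite /geom_poly (_ : tri 0 = 0) //; ring. Qed.
Let ex0 nu : exp_poly nu 0 = 1.
Proof. by rewrite /exp_poly (_ : tri 0 = 0) //; ring. Qed.

Let ff1 nu : geom_poly tau nu 1 = 1 + nu.
Proof. by rewrite /geom_poly (_ : tri 1 = 1) //; ring. Qed.
Let ex1 nu : exp_poly nu 1 = 1 + nu.
Proof. by rewrite /exp_poly (_ : tri 1 = 1) //; ring. Qed.

Let iter_left j l i :
  iter j (bar left_b) (iter l (bar left_c) (iter i (bar left_a) p0)) = lat_class (j%:Z, l%:Z, - i%:Z).
Proof.
have -> : iter i (bar left_a) p0 = lat_class (0, 0, - i%:Z).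
  elim: i => [|i IHi] //; rewrite iterS IHi barE; last exact: compat_left_a.
  by rewrite /left_a /= oppr0 ff0 ex0 oppr0 subrr; congr (lat_class (_, _, _)); lia.
have -> : iter l (bar left_c) (lat_class (0, 0, - i%:Z)) = lat_class (0, l%:Z, - i%:Z).
  elim: l => [|l IHl] //; rewrite iterS IHl barE; last exact: compat_left_c.
  by rewrite /left_c /= mulr0; congr (lat_class (_, _, _)); lia.
elim: j => [|j IHj] //; rewrite iterS IHj barE; last exact: compat_left_b.
by rewrite /left_b /=; congr (lat_class (_, _, _)); lia.
Qed.

(** Shifts by [lat_mod] make the coordinates natural. The sign [e = -1] serves the left maps, since
    [left_a] lowers the third coordinate, and [e = 1] serves the words in [pa], [pb], [pc]. *)
Let nat_rep e t : e = 1 \/ e = -1 -> exists j l i : nat, t = lat_class (j%:Z, l%:Z, e * i%:Z).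
Proof.
move=> He; rewrite -[t]lat_reprK; case: (lat_repr t) => [[j l] i].
have q0 : 0 < q by rewrite /q ltz_nat.
have M0 : 0 < 4 * q ^+ 6 by rewrite mulr_gt0 // exprn_gt0.
have N0 : 0 < 2 * q ^+ 5 by rewrite mulr_gt0 // exprn_gt0.
have [j' [a Ej]] := nat_shift j M0; have [l' [b El]] := nat_shift l N0.
have [i' [c Ei]] := nat_shift (e * i) M0.
exists j', l', i'; apply/lat_class_eq; rewrite Ej El Ei.
apply: lat_eq (lat_M (- a) (- b) (- e * c)) _ _ _; [ring|ring|].
by case: He => ->; ring.
Qed.

Let comml (F : X -> X) := forall t,
  [/\ F (bar left_a t) = bar left_a (F t), F (bar left_b t) = bar left_b (F t)
    & F (bar left_c t) = bar left_c (F t)].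

Let comml_iter F j l i t : comml F ->
  F (iter j (bar left_b) (iter l (bar left_c) (iter i (bar left_a) t))) =
  iter j (bar left_b) (iter l (bar left_c) (iter i (bar left_a) (F t))).
Proof.
move=> cF; elim: j => [|j IHj] /=; last by have [_ -> _] := cF (iter j (bar left_b) (iter l (bar left_c) (iter i (bar left_a) t))); rewrite IHj.
elim: l => [|l IHl] /=; last by have [_ _ ->] := cF (iter l (bar left_c) (iter i (bar left_a) t)); rewrite IHl.
by elim: i => [|i IHi] //=; have [-> _ _] := cF (iter i (bar left_a) t); rewrite IHi.
Qed.

Let left_transitive t : exists j l i : nat,
  t = iter j (bar left_b) (iter l (bar left_c) (iter i (bar left_a) p0)).
Proof.
have [j [l [i ->]]] := nat_rep t (or_intror erefl).
by exists j, l, i; rewrite iter_left mulN1r.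
Qed.

Let comml_eq F F' : comml F -> comml F' -> F p0 = F' p0 -> F =1 F'.
Proof. by move=> cF cF' E0 t; have [j [l [i ->]]] := left_transitive t; rewrite !comml_iter // E0. Qed.

(** If [F] reaches [p0], transitivity of the left maps makes it surjective, hence injective on a
    finite type. *)
Let comml_inj F t0 : comml F -> F t0 = p0 -> injective F.
Proof.
move=> cF E0.
have surj t : exists s, F s == t.
  have [j [l [i ->]]] := left_transitive t.
  by exists (iter j (bar left_b) (iter l (bar left_c) (iter i (bar left_a) t0))); rewrite comml_iter // E0.
pose h t := xchoose (surj t).
have hK : cancel h F by move=> t; apply/eqP/(xchooseP (surj t)).
have [h' h'K hK'] := injF_bij (can_inj hK).
by move=> s t; rewrite -[s]hK' -[t]hK' !hK => ->.
Qed.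

Let comml_a : comml (bar right_a).
Proof. by move=> t; split; [apply: commutes_aa | apply: commutes_ab | apply: commutes_ac]. Qed.
Let comml_b : comml (bar right_b).
Proof. by move=> t; split; [apply: commutes_ba | apply: commutes_bb | apply: commutes_bc]. Qed.
Let comml_c : comml (bar right_c).
Proof. by move=> t; split; [apply: commutes_ca | apply: commutes_cb | apply: commutes_cc]. Qed.

Let inj_a : injective (bar right_a).
Proof.
apply: (@comml_inj _ (lat_class (0, 0, -1)) comml_a); rewrite barE; last exact: compat_right_a.
by congr lat_class.
Qed.
Let inj_b : injective (bar right_b).
Proof.
apply: (@comml_inj _ (lat_class (-1, 0, 0)) comml_b); rewrite barE; last exact: compat_right_b.
by rewrite /right_b /= ex0 ff0.
Qed.
Let inj_c : injective (bar right_c).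
Proof.
apply: (@comml_inj _ (lat_class (0, -1, 0)) comml_c); rewrite barE; last exact: compat_right_c.
by congr lat_class; rewrite /right_c /= mulr0 addNr.
Qed.

Let pa : {perm X} := perm inj_a.
Let pb : {perm X} := perm inj_b.
Let pc : {perm X} := perm inj_c.

Definition left_centralizer : {set {perm X}} :=
  [set s : {perm X} | [forall t, [&& s (bar left_a t) == bar left_a (s t),
     s (bar left_b t) == bar left_b (s t) & s (bar left_c t) == bar left_c (s t)]]].

Let left_centralizerP (s : {perm X}) : reflect (comml s) (s \in left_centralizer).
Proof.
rewrite inE; apply: (iffP forallP) => cs t.
  by have /and3P[/eqP-> /eqP-> /eqP->] := cs t.
by have [-> -> ->] := cs t; rewrite !eqxx.
Qed.

Lemma group_set_left_centralizer : group_set left_centralizer.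
Proof.
apply/group_setP; split=> [|s s' /left_centralizerP cs /left_centralizerP cs'].
  by apply/left_centralizerP => t; rewrite !perm1.
apply/left_centralizerP => t; rewrite !permM; have [-> -> ->] := cs t.
by have [-> -> ->] := cs' (s t).
Qed.

Let C := Group group_set_left_centralizer.

Let paC : pa \in C.
Proof. by apply/left_centralizerP => t; rewrite !permE; apply: comml_a. Qed.
Let pbC : pb \in C.
Proof. by apply/left_centralizerP => t; rewrite !permE; apply: comml_b. Qed.
Let pcC : pc \in C.
Proof. by apply/left_centralizerP => t; rewrite !permE; apply: comml_c. Qed.

Let C_eq s s' : s \in C -> s' \in C -> s p0 = s' p0 -> s = s'.
Proof.
move=> /left_centralizerP cs /left_centralizerP cs' E0.
by apply/permP; apply: comml_eq.
Qed.

Let paE p : pa (lat_class p) = lat_class (right_a p).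
Proof. by rewrite permE barE //; apply: compat_right_a. Qed.
Let pbE p : pb (lat_class p) = lat_class (right_b p).
Proof. by rewrite permE barE //; apply: compat_right_b. Qed.
Let pcE p : pc (lat_class p) = lat_class (right_c p).
Proof. by rewrite permE barE //; apply: compat_right_c. Qed.

Let paX n j l i : (pa ^+ n)%g (lat_class (j, l, i)) = lat_class (j, l, i + n%:Z).
Proof.
rewrite permX; elim: n => [|n IHn]; first by rewrite addr0.
by rewrite iterS IHn paE /right_a /=; congr (lat_class (_, _, _)); lia.
Qed.

Let pbX n j : (pb ^+ n)%g (lat_class (j, 0, 0)) = lat_class (j + n%:Z, 0, 0).
Proof.
rewrite permX; elim: n => [|n IHn]; first by rewrite addr0.
by rewrite iterS IHn pbE /right_b /= ff0 ex0 addr0; congr (lat_class (_, _, _)); lia.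
Qed.

Let pcX n j l : (pc ^+ n)%g (lat_class (j, l, 0)) = lat_class (j, l + n%:Z, 0).
Proof.
rewrite permX; elim: n => [|n IHn]; first by rewrite addr0.
by rewrite iterS IHn pcE /right_c /= mulr0; congr (lat_class (_, _, _)); lia.
Qed.

Let pa_gexpz e j l i : gexpz pa e (lat_class (j, l, i)) = lat_class (j, l, i + e).
Proof.
case: e => n; first exact: paX.
apply: (canLR (permK _)); rewrite paX.
by congr (lat_class (_, _, _)); lia.
Qed.

Let pb_gexpz e j : gexpz pb e (lat_class (j, 0, 0)) = lat_class (j + e, 0, 0).
Proof.
case: e => n; first exact: pbX.
apply: (canLR (permK _)); rewrite pbX.
by congr (lat_class (_, _, _)); lia.
Qed.

Let gexpzC s e : s \in C -> gexpz s e \in C.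
Proof. by move=> Cs; case: e => n; rewrite /gexpz ?groupV groupX. Qed.

Let rel_ab : (pa * pb = pb * pa * pc)%g.
Proof.
apply: C_eq; rewrite ?groupM // !permM paE !pbE paE pcE /right_a /right_b /right_c /=.
by rewrite !ff0 !add0r ff1 mulr1.
Qed.

Let rel_ac : (pa * pc = pc * gexpz pa (1 + lam)%R)%g.
Proof.
apply: C_eq; rewrite ?groupM ?gexpzC // !permM paE !pcE pa_gexpz /right_a /right_c /=.
by rewrite mulr0 !add0r mulr1.
Qed.

Let rel_cb : (pc * pb = gexpz pb (1 + mu)%R * pc)%g.
Proof.
apply: C_eq; rewrite ?groupM ?gexpzC // !permM pb_gexpz !pcE pbE /right_b /right_c /=.
by rewrite !mulr0 ff0 !add0r ex1 addr0.
Qed.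

Lemma model_commutator : [~ pa, pb]%g = pc.
Proof. by apply: (mulgI (pb * pa)%g); rewrite -commgC rel_ab. Qed.

Lemma model_Grels : Grels (1 + lam) (1 + mu) pa pb.
Proof.
split; first by rewrite model_commutator conjgE rel_ac mulKg.
by rewrite -invgR model_commutator conjgE invgK mulgA rel_cb mulgK.
Qed.

Let R := <<[set pa; pb]>>%g.

(** Evaluation at [p0] is injective on [C], and the words [pb ^+ j * pc ^+ l * pa ^+ i] reach every
    point. *)
Lemma model_card : #|R| = (m5 * m3 * mg)%N.
Proof.
have RC : R \subset C by rewrite gen_subG subUset !sub1set paC.
have Ra : pa \in R by rewrite mem_gen // set21.
have Rb : pb \in R by rewrite mem_gen // set22.
have Rc : pc \in R by rewrite -model_commutator groupR.
have injR : {in R &, injective (fun s : {perm X} => s p0)}.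
  by move=> s s' Rs Rs'; apply: C_eq; apply: (subsetP RC).
rewrite -(card_in_imset injR) (_ : _ @: _ = setT).
  by rewrite cardsT !card_prod !card_ord.
apply/setP=> t; rewrite inE; apply/imsetP.
have [j [l [i ->]]] := nat_rep t (or_introl erefl).
exists (pb ^+ j * pc ^+ l * pa ^+ i)%g; first by rewrite !groupM ?groupX.
by rewrite !permM pbX pcX paX !add0r mul1r.
Qed.

Let order_perm s n : s \in C -> (#[s]%g %| n)%N = ((s ^+ n)%g p0 == p0).
Proof.
move=> Cs; rewrite order_dvdn; apply/eqP/eqP => [->|E]; first by rewrite perm1.
by apply: C_eq; rewrite ?group1 ?groupX // perm1.
Qed.

Let q_neq0 : q != 0. Proof. by rewrite /q eqz_nat -lt0n. Qed.
Let q3_neq0 : 2 * q ^+ 3 != 0. Proof. by rewrite mulf_neq0 // expf_neq0. Qed.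
Let q5_neq0 : 2 * q ^+ 5 != 0. Proof. by rewrite mulf_neq0 // expf_neq0. Qed.

Lemma model_order_a : #[pa]%g = mg.
Proof.
apply/eqP; rewrite eqn_dvd order_perm // paX; apply/andP; split.
  apply/eqP/lat_class_eq; exists 0, 0, 1; rewrite Emg; split; ring.
have := dvdnn #[pa]%g; rewrite order_perm // paX => /eqP/lat_class_eq[s [t [w [Ej El Ei]]]].
have s0 : s = 0 by apply: (mulfI q3_neq0); rewrite -El; ring.
have t0 : t = 0 by apply: (mulfI q5_neq0); rewrite s0 in Ej; rewrite mulr0 -[RHS]subr0 Ej; ring.
by apply: (@dvdn_of_int _ _ w); rewrite Emg -[LHS]add0r -[LHS]subr0 Ei s0 t0; ring.
Qed.

Variables (r n0 : nat).
Hypotheses (EQ : Q = (2 ^ r)%N) (EG : G = (2 ^ n0.+1)%N) (q1_even : exists q2, q1 = 2 * q2).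

(** A lattice vector [(n, 0, 0)] has [n = 2 q^5 t] with [g] dividing [z t], and [z] is odd. *)
Lemma model_order_b : #[pb]%g = mg.
Proof.
apply/eqP; rewrite eqn_dvd order_perm // pbX; apply/andP; split.
  by apply/eqP/lat_class_eq; exists 0, g, z; rewrite Emg -/z; split; ring.
have := dvdnn #[pb]%g; rewrite order_perm // pbX => /eqP/lat_class_eq[s [t [w]]].
rewrite -/x -/y -/z => -[Ej El Ei].
have s0 : s = 0 by apply: (mulfI q3_neq0); rewrite -El; ring.
rewrite s0 in Ej Ei.
have Ezt : z * t = g * w.
  apply: (mulfI q5_neq0); apply/eqP; rewrite -subr_eq0 -oppr_eq0 -(subrr 0) Ei; apply/eqP; ring.
have z_odd : z = 2 * (q1 + (u ^+ 3 - k ^+ 2)) + 1 by rewrite /z Eq; ring.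
have /dvdzP[t' Et] : (g %| t)%Z.
  have cgz : coprimez g z by rewrite /g EG; apply: pow2_coprimez z_odd.
  by rewrite -(Gauss_dvdzr _ cgz) Ezt dvdz_mulr.
apply: (@dvdn_of_int _ _ t'); rewrite Emg -[LHS]add0r -[LHS]subr0 Ej Et; ring.
Qed.

(** For a lattice vector [(0, n, 0)], [n = 2 q^3 s]; oddness of [x] makes [q] divide [s]. As
    [y + z x = 2 h] with [h] odd, only [g / 2] has to divide [s / q]. *)
Lemma model_order_c : #[pc]%g = (Q ^ 4 * G)%N.
Proof.
have [q2 Eq2] := q1_even.
have x_odd : x = 2 * (2 * (u1 - q1 * k) * (u1 - q1 * k + 1) * kap + kap1) + 1.
  by rewrite /x Ev Eu1 Eq Ekap1; ring.
pose E := u ^+ 3 - k ^+ 2.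
pose E2 := 4 * u1 ^+ 3 + 6 * u1 ^+ 2 + 3 * u1 - 2 * k1 ^+ 2 - 2 * k1.
have EE2 : E = 2 * E2 by rewrite /E /E2 Eu1 Ek1; ring.
pose h := kap * u ^+ 2 + kap * (q1 + E) * v ^+ 2 - kap * (u * q * k - q1 * q * k ^+ 2).
have Eh : y + z * x = 2 * h by rewrite /h /E /y /z /x Ev Eq; ring.
pose h1 := kap1 + 2 * kap * u1 * (u1 + 1) + kap * (q2 + E2) * v ^+ 2 - kap * (u * q1 * k - q1 * q1 * k ^+ 2).
have h_odd : h = 2 * h1 + 1.
  rewrite /h EE2 Eq Eq2 /h1; transitivity (kap * u ^+ 2 + 2 * (kap * (q2 + E2) * v ^+ 2
     - kap * (u * q1 * k - q1 * q1 * k ^+ 2))); first by rewrite Eq2; ring.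
  by rewrite {1}Eu1 Ekap1 Eq2; ring.
have E2G : g = 2 * (2 ^ n0)%N%:Z by rewrite /g EG expnS PoszM.
set g1 := (2 ^ n0)%N%:Z in E2G.
have EQG : (Q ^ 4 * G)%N%:Z = q ^+ 4 * g by rewrite PoszM -[Posz (Q ^ 4)]natz natrX natz.
apply/eqP; rewrite eqn_dvd order_perm // pcX; apply/andP; split.
  apply/eqP/lat_class_eq; exists (q * g1), (x * g1), h; rewrite EQG -/x -/y -/z E2G; split; [ring|ring|].
  transitivity (2 * q ^+ 5 * g1 * (2 * h) - 2 * q ^+ 5 * g1 * (y + z * x)); last by ring.
  by rewrite Eh; ring.
have := dvdnn #[pc]%g; rewrite order_perm // pcX => /eqP/lat_class_eq[s [t [w]]].
rewrite -/x -/y -/z => -[Ej El Ei].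
have q4_neq0 : 2 * q ^+ 4 != 0 by rewrite mulf_neq0 // expf_neq0.
have Exs : x * s = q * t.
  apply: (mulfI q4_neq0); apply/eqP; rewrite -subr_eq0 -oppr_eq0 -(subrr 0) Ej; apply/eqP; ring.
have /dvdzP[s' Es] : (q %| s)%Z.
  have cqx : coprimez q x by rewrite /q EQ; apply: pow2_coprimez x_odd.
  by rewrite -(Gauss_dvdzr _ cqx) Exs dvdz_mulr.
have Et : t = x * s' by apply: (mulfI q_neq0); rewrite -Exs Es; ring.
have Ehs : h * s' = g1 * w.
  apply: (mulfI q5_neq0); apply: mul2I.
  transitivity (2 * q ^+ 5 * ((y + z * x) * s')); first by rewrite Eh; ring.
  transitivity (2 * q ^+ 5 * (g * w)); last by rewrite E2G; ring.
  apply/eqP; rewrite -subr_eq0 -oppr_eq0 -(subrr 0) Ei Es Et; apply/eqP; ring.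
have /dvdzP[s2 Es2] : (g1 %| s')%Z.
  by rewrite -(Gauss_dvdzr _ (pow2_coprimez n0 h_odd)) Ehs dvdz_mulr.
apply: (@dvdn_of_int _ _ s2); rewrite EQG -[LHS]add0r -[LHS]subr0 El Es Es2 E2G; ring.
Qed.

Lemma model_exists : exists (hT : finGroupType) (a b : hT),
  [/\ Grels (1 + lam) (1 + mu) a b, #|<<[set a; b]>>%g| = (m5 * m3 * mg)%N,
     #[a]%g = mg, #[b]%g = mg & #[[~ a, b]]%g = (Q ^ 4 * G)%N].
Proof.
exists {perm X}, pa, pb; split.
- exact: model_Grels.
- exact: model_card.
- exact: model_order_a.
- exact: model_order_b.
by rewrite model_commutator; exact: model_order_c.
Qed.

End Permutations.

Lemma int_parity (a : int) : (exists b, a = 2 * b) \/ (exists b, a = 2 * b + 1).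
Proof.
have [b [e Ea]] : exists b e : int, a = 2 * b + e /\ (e = 0 \/ e = 1).
  exists (a %/ 2)%Z, (a %% 2)%Z; split; first by rewrite {1}(divz_eq a 2) mulrC.
  have := @modz_ge0 a 2 isT; have := @ltz_pmod a 2 isT; lia.
by case: Ea => ->; case=> ->; [left | right]; exists b; rewrite ?addr0.
Qed.

Lemma finite_model (r n0 : nat) (u v k u1 k1 E' : int) (Q := (2 ^ r)%N) (G := (2 ^ n0.+1)%N) :
  (1 < r)%N -> (n0 <= r)%N -> u = 2 * u1 + 1 -> k = 2 * k1 + 1 -> v = u - Q%:Z * k ->
  4 * (u ^+ 3 - k ^+ 2) = G%:Z * E' ->
  exists (hT : finGroupType) (a b : hT),
  [/\ Grels (1 + 2 * Q%:Z ^+ 2 * u) (1 + 2 * Q%:Z ^+ 2 * v) a b,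
     #|<<[set a; b]>>%g| = (2 * Q ^ 5 * (2 * Q ^ 3) * (2 * Q ^ 5 * G))%N,
     #[a]%g = (2 * Q ^ 5 * G)%N, #[b]%g = (2 * Q ^ 5 * G)%N & #[[~ a, b]]%g = (Q ^ 4 * G)%N].
Proof.
move=> r_gt1 n0r Eu1 Ek1 Ev EE.
have Q_gt0 : (0 < Q)%N by rewrite expn_gt0.
have Eq : Q%:Z = 2 * (2 ^ r.-1)%N%:Z by rewrite /Q -{1}(prednK (ltnW r_gt1)) expnS PoszM.
have Eq1 : exists q2 : int, (2 ^ r.-1)%N%:Z = 2 * q2.
  by exists (2 ^ r.-2)%N%:Z; rewrite -PoszM -expnS; congr (2 ^ _)%N%:Z; lia.
have Eg : 2 * Q%:Z = G%:Z * (2 ^ (r - n0))%N%:Z.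
  by rewrite /Q /G -!PoszM -expnS -expnD; congr (2 ^ _)%N%:Z; lia.
have odd_coprime (a b : int) n : a = 2 * b + 1 -> exists c d, a * c = 1 + (2 ^ n)%N%:Z * d.
  move=> /(pow2_coprimez n) /coprimezP[[d c] /= E].
  by exists c, (- d); rewrite -E; ring.
(* The inverses of [k] modulo [2 q^2 = 2^(2r+1)] and, below, of 3 modulo [4 q^6 = 2^(6r+2)]. *)
have [kap [om0 Ekap0]] := odd_coprime _ _ (2 * r).+1 Ek1.
have Ekap : k * kap = 1 + 2 * Q%:Z ^+ 2 * om0.
  by rewrite Ekap0 expnS PoszM mulnC expnM -[Posz (_ ^ 2)]natz natrX natz.
have [tau [ta0 Etau0]] := odd_coprime 3 1 (6 * r).+2 erefl.
have Etau : 3 * tau = 1 + 4 * Q%:Z ^+ 6 * ta0.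
  by rewrite Etau0 !expnS mulnA PoszM mulnC expnM -[Posz (_ ^ 6)]natz natrX natz.
have [kap1 Ekap1] : exists b, kap = 2 * b + 1.
  case: (int_parity kap) => // -[b Eb]; exfalso.
  have : 2 * (k * b - Q%:Z ^+ 2 * om0) = 1 by rewrite mulrBr mulrCA -Eb Ekap; ring.
  by lia.
have G_gt0 : (0 < G)%N by rewrite expn_gt0.
exact: (model_exists Q_gt0 G_gt0 Eq Ev Ekap Eu1 Ek1 Ekap1 Eg EE Etau erefl erefl Eq1).
Qed.

End LowerBound.

(** * The Sylow subgroup *)

Lemma gexpz_nat (gT : finGroupType) (x : gT) (e t : int) (n : nat) :
  (n%:Z = e + #[x]%g%:Z * t)%R -> gexpz x e = (x ^+ n)%g.
Proof.
case: e => p E /=; last first.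
  apply/eqP; rewrite eq_invg_mul -expgD -order_dvdn.
  by apply: (@dvdn_of_int _ _ t); lia.
apply/eqP; rewrite eq_expg_mod_order; apply/eqP/esym.
have Em : (n%:Z %% #[x]%g = p%:Z %% #[x]%g)%Z by rewrite E addrC mulrC modzMDl.
by apply: (can_inj (f := Posz) (g := absz)) => //; rewrite -!modz_nat.
Qed.

Lemma v2_odd_part (e : int) (n : nat) : (e != 0)%R -> v2 e = n ->
  exists o : int, (e = (2 ^ n)%N%:Z * (2 * o + 1))%R.
Proof.
move=> e0 <-; rewrite /v2; have a0 : 0 < `|e|%N by rewrite absz_gt0.
case: (pfactor_coprime (isT : prime 2) a0) => o; rewrite coprime2n => o_odd Ee.
have Eo := odd_double_half o; rewrite o_odd -mul2n in Eo.
have Ee' : (`|e|%N%:Z = (2 ^ logn 2 `|e|)%N%:Z * o%:Z)%R by rewrite -PoszM mulnC -Ee.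
have : (e = `|e|%N%:Z \/ e = - `|e|%N%:Z)%R by lia.
case=> {1}->; rewrite Ee'.
  by exists (o./2)%:Z%R; congr (_ * _)%R; lia.
by exists (- (o./2)%:Z - 1)%R; rewrite -mulrN; congr (_ * _)%R; lia.
Qed.

Section MainTheorem.
Variables (al be : int) (r : nat) (u1 v1 k1 : int).
Let Q := 2 ^ r.
Let q : int := Q%:Z.
Let u : int := (2 * u1 + 1)%R.
Let v : int := (2 * v1 + 1)%R.
Let k : int := (2 * k1 + 1)%R.
Hypotheses (r_gt1 : 1 < r) (Ev : (v = u - q * k)%R).
Hypotheses (Eal : (al = 1 + 2 * q ^+ 2 * u)%R) (Ebe : (be = 1 + 2 * q ^+ 2 * v)%R).
Variables (n0 : nat) (E' : int).
Hypotheses (n0_gt1 : 1 < n0) (n0r : n0 <= r).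
Hypothesis EE : (4 * (u ^+ 3 - k ^+ 2) = (2 ^ n0.+1)%N%:Z * E')%R.
Hypothesis n0_max : n0 = r \/ exists s o, [/\ n0 = s.+1, s < r & (u ^+ 3 - k ^+ 2 = (2 ^ s)%N%:Z * (2 * o + 1))%R].
Variables (gT : finGroupType) (a b : gT).
Hypothesis G2 : is_G2 al be a b.
Let G := <<[set a; b]>>%g.
Let c := [~ a, b]%g.

Let a2 : (2.-elt a)%g.
Proof. by have [pG _ _] := G2; apply: mem_p_elt pG _; rewrite mem_gen // set21. Qed.
Let b2 : (2.-elt b)%g.
Proof. by have [pG _ _] := G2; apply: mem_p_elt pG _; rewrite mem_gen // set22. Qed.

(* Exponents matter only modulo #|G|, so u, v and k may be replaced by natural numbers. *)
Let nat_parameters : exists u' v' k' : nat,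
  [/\ odd u', odd v', odd k', u' = v' + Q * k' & macdonald_rels (1 + 2 * Q ^ 2 * u') (1 + 2 * Q ^ 2 * v') a b c] /\
  exists t1 t2 t3 : int, [/\ u'%:Z = u + 2 * q * t1, v'%:Z = v + 2 * q * t2 & k'%:Z = k + 2 * q * t3]%R.
Proof.
have [pG [Ga Gb] _] := G2.
(* Shifts by multiples of [2 q #|G|] preserve parities, and the lift of [u] is defined from those of
   [v] and [k] so that [u = v + q k] holds exactly. *)
have Gpos : (0 < 2 * q * #|G|%:Z)%R.
  by rewrite !mulr_gt0 // ltz_nat ?expn_gt0 ?cardG_gt0.
have [v' [t2 E2]] := nat_shift v Gpos; have [k' [t3 E3]] := nat_shift k Gpos.
exists (v' + Q * k'), v', k'.
have EU : ((v' + Q * k')%N%:Z = u + 2 * q * #|G|%:Z * (t2 + q * t3))%R.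
  by rewrite PoszD PoszM E2 E3 Ev -/q; ring.
have oG (x : gT) : x \in G -> exists w, #|G| = #[x]%g * w.
  by move=> Gx; have /dvdnP[w ->] := order_dvdG Gx; exists w; rewrite mulnC.
have [wa Ewa] : exists w, #|G| = #[a]%g * w by apply: oG; rewrite mem_gen // set21.
have [wb Ewb] : exists w, #|G| = #[b]%g * w by apply: oG; rewrite mem_gen // set22.
have oddP (x y : int) (n : nat) : (n%:Z = 2 * x + 1 + 2 * q * y)%R -> odd n by lia.
split; last first.
  exists (#|G|%:Z * (t2 + q * t3))%R, (#|G|%:Z * t2)%R, (#|G|%:Z * t3)%R.
  by rewrite EU E2 E3; split; ring.
split.
- by apply: (oddP u1 (#|G|%:Z * (t2 + q * t3))%R); rewrite EU /u; ring.
- by apply: (oddP v1 (#|G|%:Z * t2)%R); rewrite E2 /v; ring.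
- by apply: (oddP k1 (#|G|%:Z * t3)%R); rewrite E3 /k; ring.
- by [].
have EX n : ((1 + 2 * Q ^ 2 * n)%N%:Z = 1 + 2 * q ^+ 2 * n%:Z)%R.
  by rewrite PoszD !PoszM /q; ring.
split.
- by rewrite /c -commgC.
- have <- : gexpz a al = (a ^+ (1 + 2 * Q ^ 2 * (v' + Q * k')))%g.
    apply: (@gexpz_nat _ _ _ (4 * q ^+ 3 * wa%:Z * (t2 + q * t3))%R).
    by rewrite EX EU Eal Ewa PoszM; ring.
  by rewrite -Ga; apply: conjgC.
have <- : gexpz b be = (b ^+ (1 + 2 * Q ^ 2 * v'))%g.
  apply: (@gexpz_nat _ _ _ (4 * q ^+ 3 * wb%:Z * t2)%R).
  by rewrite EX E2 Ebe Ewb PoszM; ring.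
by rewrite -Gb -invgR; apply: conjgCV.
Qed.
(** For [n0 = r] this is [order_dvd_4q6]. Otherwise [v'^3 - k'^2] agrees with [u^3 - k^2] modulo
    [q = 2^r], and [s < r], so both have valuation [s] and [order_a_bound] applies. *)
Let order_a_dvd : (a ^+ (2 * Q ^ 5 * 2 ^ n0.+1) = 1)%g.
Proof.
have [u' [v' [k' [[u'_odd v'_odd k'_odd Euv rels] [t1 [t2 [t3 [Eu' Ev' Ek']]]]]]]] := nat_parameters.
case: n0_max => [->|[s [o [-> s_r Eo]]]].
  have [a4 _] := order_dvd_4q6 r_gt1 u'_odd v'_odd Euv rels a2 b2.
  by rewrite -[RHS]a4 (expnS 2 r) -/Q; congr (_ ^+ _)%g; ring.
have Eq : (q = (2 ^ s)%N%:Z * (2 * (2 ^ (r - s.+1))%N%:Z))%R.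
  by rewrite /q /Q -!PoszM -expnS -expnD; congr (Posz (2 ^ _)); lia.
have [o' Eo'] : exists o' : int, (v'%:Z ^+ 3 - k'%:Z ^+ 2 = (2 ^ s)%N%:Z * (2 * o' + 1))%R.
  exists (o + (2 ^ (r - s.+1))%N%:Z * (- 3 * k * u ^+ 2 + 3 * q * k ^+ 2 * u - q ^+ 2 * k ^+ 3
     + 6 * v ^+ 2 * t2 + 12 * v * q * t2 ^+ 2 + 8 * q ^+ 2 * t2 ^+ 3 - 4 * k * t3 - 4 * q * t3 ^+ 2))%R.
  transitivity ((u ^+ 3 - k ^+ 2) + q * (- 3 * k * u ^+ 2 + 3 * q * k ^+ 2 * u - q ^+ 2 * k ^+ 3
     + 6 * v ^+ 2 * t2 + 12 * v * q * t2 ^+ 2 + 8 * q ^+ 2 * t2 ^+ 3 - 4 * k * t3 - 4 * q * t3 ^+ 2))%R.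
    by rewrite Ev' Ek' Ev; ring.
  by rewrite Eo {1}Eq; ring.
have odd_o : odd (absz (2 * o' + 1)%R) by lia.
apply: (order_a_bound r_gt1 u'_odd v'_odd k'_odd Euv rels a2 b2 odd_o).
have EX (x n : nat) : ((x ^ n)%N%:Z = x%:Z ^+ n)%R by rewrite -[LHS]natz natrX natz.
rewrite EX in Eo'.
have [o_ge0|o_lt0] : (0 <= 2 * o' + 1 \/ 2 * o' + 1 < 0)%R by lia.
  by left; apply: (can_inj (f := Posz) (g := absz)) => //; rewrite PoszD PoszM !EX gez0_abs // -Eo'; ring.
by right; apply: (can_inj (f := Posz) (g := absz)) => //; rewrite PoszD PoszM !EX ltz0_abs // mulrN -Eo'; ring.
Qed.

(** The universal property maps the group onto the finite model, whose order equals the upper bound.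
    The map is therefore injective and carries the orders of the model back to [a], [b] and [c]. *)
Lemma G2_structure :
  [/\ nil_class G = 6, #|G| = 2 * Q ^ 5 * (2 * Q ^ 3) * (2 * Q ^ 5 * 2 ^ n0.+1),
     #[a]%g = 2 * Q ^ 5 * 2 ^ n0.+1, #[b]%g = 2 * Q ^ 5 * 2 ^ n0.+1 & #[c]%g = Q ^ 4 * 2 ^ n0.+1].
Proof.
have [u' [v' [k' [[u'_odd v'_odd k'_odd Euv rels] _]]]] := nat_parameters.
have [pG _ univ] := G2.
have Ga : a \in G by rewrite mem_gen // set21.
have Gb : b \in G by rewrite mem_gen // set22.
have [hT [x [y [xy_rels cardR ox oy oxy]]]] := finite_model r_gt1 n0r erefl erefl Ev EE.
rewrite -/Q -/q -Eal -Ebe in xy_rels cardR ox oy oxy.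
have pR : pgroup 2 <<[set x; y]>>%g.
  by rewrite /pgroup cardR /Q !pnatM !pnatX.
have [f [fa fb]] := univ _ _ _ xy_rels pR.
have fG : (f @* G)%g = <<[set x; y]>>%g.
  rewrite morphim_gen ?subset_gen // morphimU !morphim_set1 ?fa ?fb //.
have oa_le : #[a]%g <= 2 * Q ^ 5 * 2 ^ n0.+1.
  by rewrite dvdn_leq ?order_dvdn ?order_a_dvd // !muln_gt0 !expn_gt0.
have cardG : #|G| = 2 * Q ^ 5 * (2 * Q ^ 3) * (2 * Q ^ 5 * 2 ^ n0.+1).
  apply/eqP; rewrite eqn_leq -{2}cardR -fG leq_morphim andbT.
  apply: leq_trans (card_gen2_bound r_gt1 u'_odd v'_odd k'_odd Euv rels a2 b2) _.
  by rewrite leq_mul2l oa_le orbT.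
have injf : ('injm f)%g by rewrite -card_im_injm fG cardR cardG.
have oc : #[c]%g = Q ^ 4 * 2 ^ n0.+1.
  by rewrite -oxy -fa -fb -morphR // order_injm // groupR.
split=> //; last 2 first.
- by rewrite -ox -fa order_injm.
- by rewrite -oy -fb order_injm.
have nilG : nilpotent G := pgroup_nil pG.
have := ucn6_gen2 r_gt1 u'_odd v'_odd Euv rels a2 b2 => Z6.
apply/eqP; rewrite eqn_leq; apply/andP; split.
  by apply/(ucn_nil_classP _ nilG).
rewrite ltnNge; apply/negP => /(lcn_nil_classP _ nilG) L6.
(* Class at most 5 would give [c ^+ (4 q^4) = 1], while the order of [c] is at least [8 q^4]. *)
have := c_in_lcn6 r_gt1 u'_odd v'_odd Euv rels a2 b2.
rewrite -/G L6 inE -order_dvdn oc -/Q => /dvdn_leq.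
have Q4 : 0 < Q ^ 4 by rewrite !expn_gt0.
have n8 : 8 <= 2 ^ n0.+1 by rewrite (@leq_pexp2l 2 3).
by rewrite muln_gt0 Q4 => /(_ isT); rewrite mulnC leq_pmul2r // => /(leq_trans n8).
Qed.

End MainTheorem.

Theorem theorem16p3 (al be : int) (m l : nat) (gT : finGroupType) (a b : gT) :
  (al != 1)%R -> (be != 1)%R ->
  v2 (al - 1)%R = m -> v2 (be - 1)%R = m -> 5 <= m ->
  v2 (al - be)%R = l -> 2 * l + 2 = 3 * m + 1 ->
  is_G2 al be a b ->
  let u : int := ((al - 1)%R %/ (2 ^ m)%:Z)%Z in
  let k : int := ((al - be)%R %/ (2 ^ l)%:Z)%Z in
  let s : nat := v2 (k ^+ 2 - u ^+ 3)%R in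
  let G := <<[set a; b]>>%g in
  nil_class G = 6 /\
  (((k ^+ 2 - u ^+ 3 != 0)%R && (2 * s < m - 3)) ->
     [/\ 7 <= m,
         #|G| = 2 ^ ((13 * m + 2 * s - 3) %/ 2),
         #[a]%g = 2 ^ ((5 * m + 2 * s + 1) %/ 2),
         #[b]%g = 2 ^ ((5 * m + 2 * s + 1) %/ 2) &
         #[[~ a, b]]%g = 2 ^ (2 * m + s)]) /\
  (~~ ((k ^+ 2 - u ^+ 3 != 0)%R && (2 * s < m - 3)) ->
     [/\ #|G| = 2 ^ (7 * m - 3),
         #[a]%g = 2 ^ (3 * m - 1),
         #[b]%g = 2 ^ (3 * m - 1) &
         #[[~ a, b]]%g = 2 ^ ((5 * m - 3) %/ 2)]).
Proof.
move=> al1 be1 val vbe m5 vl El HG2 u k s G.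
have [r [r_gt1 Em Elr]] : exists r, [/\ 1 < r, m = 2 * r + 1 & l = 3 * r + 1].
  by exists (m./2); split; lia.
have al1' : (al - 1 != 0)%R by rewrite subr_eq0.
have be1' : (be - 1 != 0)%R by rewrite subr_eq0.
have albe : (al - be != 0)%R.
  by apply/negP => /eqP E; move: vl; rewrite E /v2 absz0 logn0; lia.
have [u1 Eu1] := v2_odd_part al1' val.
have [v1 Ev1] := v2_odd_part be1' vbe.
have [k1 Ek1] := v2_odd_part albe vl.
have pow2_neq0 n : ((2 ^ n)%N%:Z != 0)%R by rewrite eqz_nat -lt0n expn_gt0.
have Eu : u = (2 * u1 + 1)%R by rewrite /u Eu1 mulKz.
have Ek : k = (2 * k1 + 1)%R by rewrite /k Ek1 mulKz.
set q : int := (2 ^ r)%N%:Z%R.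
have q0 : (2 * q ^+ 2 != 0)%R by rewrite mulf_neq0 // expf_neq0 // pow2_neq0.
have EX (x n : nat) : ((x ^ n)%N%:Z = x%:Z ^+ n)%R by rewrite -[LHS]natz natrX natz.
have E2m : ((2 ^ m)%N%:Z = 2 * q ^+ 2)%R by rewrite Em addn1 expnS PoszM mulnC expnM EX.
have E2l : ((2 ^ l)%N%:Z = 2 * q ^+ 3)%R by rewrite Elr addn1 expnS PoszM mulnC expnM EX.
have Eal : (al = 1 + 2 * q ^+ 2 * (2 * u1 + 1))%R by rewrite -E2m -Eu1; ring.
have Ebe : (be = 1 + 2 * q ^+ 2 * (2 * v1 + 1))%R by rewrite -E2m -Ev1; ring.
have Ev : (2 * v1 + 1 = 2 * u1 + 1 - q * (2 * k1 + 1))%R.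
  apply: (mulfI q0); transitivity (2 * q ^+ 2 * (2 * u1 + 1) - (al - be))%R.
    by rewrite Eal Ebe; ring.
  by rewrite Ek1 E2l; ring.
have main n0 E' n0_gt1 n0r EE n0_max :=
  @G2_structure al be r u1 v1 k1 r_gt1 Ev Eal Ebe n0 E' n0_gt1 n0r EE n0_max gT a b HG2.
have E5 n : 2 * (2 ^ r) ^ 5 * 2 ^ n.+1 = 2 ^ (5 * r + n + 2).
  by rewrite mulnC -expnM -expnS -expnD; congr (2 ^ _); lia.
have E4 n : (2 ^ r) ^ 4 * 2 ^ n.+1 = 2 ^ (4 * r + n + 1).
  by rewrite -expnM -expnD; congr (2 ^ _); lia.
have E3 n : 2 * (2 ^ r) ^ 5 * (2 * (2 ^ r) ^ 3) * 2 ^ (5 * r + n + 2) = 2 ^ (13 * r + n + 4).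
  by rewrite -!expnM -!expnS -!expnD; congr (2 ^ _); lia.
have Epar : (u ^+ 3 - k ^+ 2 = 2 * (4 * u1 ^+ 3 + 6 * u1 ^+ 2 + 3 * u1 - 2 * k1 ^+ 2 - 2 * k1))%R.
  by rewrite Eu Ek; ring.
have odd_part : (k ^+ 2 - u ^+ 3 != 0)%R ->
    exists o, (u ^+ 3 - k ^+ 2 = (2 ^ s)%N%:Z * (2 * o + 1))%R.
  move=> /v2_odd_part/(_ erefl)[o Eo]; exists (- o - 1)%R.
  by rewrite -opprB Eo -/s; ring.
rewrite -Eu -Ek in main; rewrite -/G in main *.
clearbody s u k.
have [cond | cond] := boolP ((k ^+ 2 - u ^+ 3 != 0)%R && (2 * s < m - 3)).
  have [ku0 sm] := andP cond; have [o Eo] := odd_part ku0.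
  (* Here [n0 = s + 1]. Since [u] and [k] are odd, [s] is positive, so [r] is at least 3 and [m] at
     least 7. *)
  have sr : s.+1 < r by rewrite Em in sm; clear -sm; lia.
  have s0 : 0 < s.
    rewrite lt0n; apply/eqP => s0; move: Eo; rewrite Epar s0 mul1r.
    by move: (_ - 2 * k1)%R => w; clear; lia.
  have EE : (4 * (u ^+ 3 - k ^+ 2) = (2 ^ s.+2)%N%:Z * (2 * o + 1))%R.
    by rewrite Eo (expnS 2 s.+1) (expnS 2 s) !PoszM; ring.
  have n0_max : s.+1 = r \/ exists s' o', [/\ s.+1 = s'.+1, s' < r
      & (u ^+ 3 - k ^+ 2 = (2 ^ s')%N%:Z * (2 * o' + 1))%R].
    by right; exists s, o; split=> //; apply: ltnW.
  have [] := main s.+1 _ s0 (ltnW sr) EE n0_max.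
  rewrite E5 E4 E3 => ncl cG oa ob oc.
  split=> //; split=> // _; rewrite cG oa ob oc Em.
  by clear -r_gt1 sr s0; split; [lia | | | | ]; congr (2 ^ _); lia.
(* Here [n0 = r]: either [u^3 = k^2], where the value of [s] is only a convention, or [s + 1 >= r]
   and [2^(r+1)] divides [4 * 2^s]. *)
have [E' EE] : exists E' : int, (4 * (u ^+ 3 - k ^+ 2) = (2 ^ r.+1)%N%:Z * E')%R.
  have [ku0|ku0] := eqVneq (k ^+ 2 - u ^+ 3)%R 0%R.
    by exists 0%R; rewrite -opprB ku0; ring.
  have [o Eo] := odd_part ku0; rewrite ku0 /= -leqNgt Em in cond.
  exists ((2 ^ (s + 1 - r))%N%:Z * (2 * o + 1))%R.
  rewrite Eo !mulrA; congr (_ * _)%R; rewrite -!PoszM -expnD.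
  by rewrite -(expnD 2 2 s); congr (Posz (2 ^ _)); clear -cond r_gt1; lia.
have [] := main r _ r_gt1 (leqnn r) EE (or_introl erefl).
rewrite E5 E4 E3 => ncl cG oa ob oc.
split=> //; split=> // _; rewrite cG oa ob oc Em.
by clear -r_gt1; split; congr (2 ^ _); lia.
Qed.
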